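(* Let $\mathbb{G}=F_n\times\mathbb{Z}^m$. There exists an algorithm which, on input a finitely generated subgroup $\mathcal{H}\leqslant\mathbb{G}$ (given by a finite generating set) and an element $ut^{\mathbf{a}}\in\mathbb{G}$, outputs $\mathrm{Ord}_{\mathcal{H}}(ut^{\mathbf{a}})$. That is, the order problem for $\mathbb{G}$ is computable.
   Context: Elements of $F_n\times\mathbb{Z}^m$ are written $ut^{\mathbf{a}}$ with $u\in F_n$ and $\mathbf{a}\in\mathbb{Z}^m$. For $g\in\mathbb{G}$, $\mathrm{Ord}_{\mathcal{H}}(g)=\min\{k\geq1:g^k\in\mathcal{H}\}$ if such $k$ exists and $0$ otherwise. *)

(* Defs.v *)
From mathcomp Require Import all_boot all_order all_algebra.
Set Implicit Arguments. Unset Strict Implicit. Unset Printing Implicit Defensive.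
Import GRing.Theory.
Local Open Scope ring_scope.

(* A letter of F_n: (true, i) = x_i, (false, i) = x_i^{-1}. *)
Definition letter (n : nat) := (bool * 'I_n)%type.
Definition inv_letter n (x : letter n) : letter n := (~~ x.1, x.2).

Definition reduce n (w : seq (letter n)) : seq (letter n) :=
  foldr (fun x acc => match acc with
                      | y :: t => if y == inv_letter x then t else x :: acc
                      | [::] => [:: x] end) [::] w.

(* An element u t^a of F_n x Z^m: a word u (representing its free-group
   element) together with an exponent vector a in Z^m. *)
Definition elt (n m : nat) := (seq (letter n) * {ffun 'I_m -> int})%type.

Definition oneG n m : elt n m := ([::], [ffun _ => 0]).
Definition mulG n m (g h : elt n m) : elt n m :=
  (reduce (g.1 ++ h.1), [ffun i => g.2 i + h.2 i]).
Definition invG n m (g : elt n m) : elt n m :=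
  (rev (map (@inv_letter n) g.1), [ffun i => - g.2 i]).
Definition eqG n m (g h : elt n m) : Prop :=
  reduce g.1 = reduce h.1 /\ g.2 = h.2.
Definition expG n m (g : elt n m) (k : nat) : elt n m :=
  iter k (mulG g) (oneG n m).

Definition in_gen n m (gens : seq (elt n m)) (g : elt n m) : Prop :=
  exists s : seq (bool * elt n m),
    all (fun p => p.2 \in gens) s /\
    eqG (foldr (fun p acc => mulG (if p.1 then p.2 else invG p.2) acc)
               (oneG n m) s) g.

Definition is_Ord n m (gens : seq (elt n m)) (g : elt n m) (k : nat) : Prop :=
  if k == 0%N then (forall j : nat, (1 <= j)%N -> ~ in_gen gens (expG g j))
  else in_gen gens (expG g k) /\
       (forall j : nat, (1 <= j < k)%N -> ~ in_gen gens (expG g j)).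

(* A model of computation: (partial) mu-recursive functions on nat,
   with a big-step evaluation relation.  "There exists an algorithm"
   is rendered as "there exists a mu-recursive program", so that the
   statement cannot be discharged with a classically chosen,
   non-computable function. *)
Inductive prog : Type :=
| PZero
| PSucc
| PProj (i : nat)
| PComp (f : prog) (gs : seq prog)
| PPrec (f g : prog)
| PMu (f : prog).

Inductive eval : prog -> seq nat -> nat -> Prop :=
| eZero v : eval PZero v 0
| eSucc x v : eval PSucc (x :: v) x.+1
| eProj i v : (i < size v)%N -> eval (PProj i) v (nth 0%N v i)
| eComp f gs v ws y : evals gs v ws -> eval f ws y -> eval (PComp f gs) v y
| ePrec0 f g v y : eval f v y -> eval (PPrec f g) (0%N :: v) y
| ePrecS f g k v r y :
    eval (PPrec f g) (k :: v) r -> eval g (k :: r :: v) y ->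
    eval (PPrec f g) (k.+1 :: v) y
| eMu f v k :
    eval f (k :: v) 0 ->
    (forall j, (j < k)%N -> exists r, eval f (j :: v) r.+1) ->
    eval (PMu f) v k
with evals : seq prog -> seq nat -> seq nat -> Prop :=
| eNil v : evals [::] v [::]
| eCons g gs v w ws : eval g v w -> evals gs v ws -> evals (g :: gs) v (w :: ws).

Definition encode_input n m (gens : seq (elt n m)) (g : elt n m) : nat :=
  pickle (gens, g).

(* Main.v *)
Require Import Defs.
From mathcomp Require Import all_boot all_order all_algebra zify ring boolp.

(* Both "g^j is in H" and its negation, and both "some positive power of g is in
   H" and its negation, have finite certificates that a computable function can
   check, so unbounded search decides them.  Membership is certified by a word in
   the generators.  For the rest, let P be the projection of H to F_n and consider
   the cosets of P in F_n.  The subgraph of the Schreier graph spanned by finitely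
   many cosets is a folded automaton in which every closed path at P spells an
   element of P; choosing, for every edge, an exponent vector that lifts it to H,
   and applying a functional lam : Z^m -> Z, gives integer edge weights.  If lam
   vanishes modulo M on L = H /\ Z^m and the automaton reads the generators, then
   every u t^a in H labels a closed path of weight lam(a) mod M, a property that
   can be checked on the generators alone.  Elements u t^a outside H violate it
   for a suitable lam, since a vector outside L is separated from L by a functional
   modulo some M.  No positive power of u t^a is in H if a closed path u^k has
   weight different from k lam(a) with M = 0, or if no power of u is in P; in the
   latter case, writing u = c r c^-1 with r cyclically reduced, some c r^k, which
   is the first half of the reduced form of u^(2k), leaves the automaton. *)

Set Implicit Arguments. Unset Strict Implicit. Unset Printing Implicit Defensive.
Import GRing.Theory Num.Theory.

(** * Mu-recursive functions of natural numbers *)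

(** The arity is fixed because a projection out of range has no value under [eval]; on lists of
    another length nothing is asked of [p]. *)
Definition crec (k : nat) (f : seq nat -> nat) : Prop :=
  exists p, forall v, size v = k -> eval p v (f v).

Definition crecs (k : nat) (F : seq nat -> seq nat) : Prop :=
  exists ps, forall v, size v = k -> evals ps v (F v).

Lemma eq_crec k f g : (forall v, size v = k -> f v = g v) -> crec k f -> crec k g.
Proof. by move=> fg [p pP]; exists p => v vk; rewrite -fg //; apply: pP. Qed.

Lemma crec_proj k i : i < k -> crec k (nth 0 ^~ i).
Proof. by move=> ik; exists (PProj i) => v vk; apply: eProj; rewrite vk. Qed.

Lemma crecs_nil k : crecs k (fun=> [::]).
Proof. by exists [::] => v _; apply: eNil. Qed.

Lemma crecs_cons k f F :
  crec k f -> crecs k F -> crecs k (fun v => f v :: F v).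
Proof.
move=> [p pP] [ps psP]; exists (p :: ps) => v vk.
by apply: eCons; [apply: pP | apply: psP].
Qed.

Lemma crecs_id k : crecs k id.
Proof.
have [ps psP] : exists ps, forall v, size v = k ->
    evals ps v (map (nth 0 v) (iota 0 k)).
  have : all (ltn^~ k) (iota 0 k) by apply/allP=> i; rewrite mem_iota.
  elim: (iota 0 k) => [_|i s IHs /= /andP[ik /IHs[ps psP]]].
    by exists [::] => v _; apply: eNil.
  exists (PProj i :: ps) => v vk; apply: eCons; last exact: psP.
  by apply: eProj; rewrite vk.
exists ps => v vk; have := psP v vk.
by rewrite -vk -/(mkseq (nth 0 v) (size v)) mkseq_nth.
Qed.

Lemma crec_comp k l f F : (forall v, size v = k -> size (F v) = l) ->
  crec l f -> crecs k F -> crec k (fun v => f (F v)).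
Proof.
move=> sF [p pP] [ps psP]; exists (PComp p ps) => v vk.
by apply: (eComp (psP v vk)); apply/pP/sF.
Qed.

Lemma crec_comp1 (f : nat -> nat) k g :
  crec 1 (fun v => f (nth 0 v 0)) -> crec k g -> crec k (fun v => f (g v)).
Proof.
move=> cf cg; apply: (@crec_comp k 1 (fun w => f (nth 0 w 0)) (fun v => [:: g v])) => //.
by apply: crecs_cons => //; apply: crecs_nil.
Qed.

Lemma crec_comp2 (f : nat -> nat -> nat) k g h :
  crec 2 (fun v => f (nth 0 v 0) (nth 0 v 1)) -> crec k g -> crec k h ->
  crec k (fun v => f (g v) (h v)).
Proof.
move=> cf cg ch; apply: (@crec_comp k 2 (fun w => f (nth 0 w 0) (nth 0 w 1))
  (fun v => [:: g v; h v])) => //.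
by do 2!apply: crecs_cons => //; apply: crecs_nil.
Qed.

Lemma crec_succ k f : crec k f -> crec k (fun v => (f v).+1).
Proof.
apply: crec_comp1; exists PSucc => [] [|x []] // _; exact: eSucc.
Qed.

Lemma crec_const k c : crec k (fun=> c).
Proof.
elim: c => [|c IHc]; last exact: crec_succ.
by exists PZero => v _; apply: eZero.
Qed.

(** [PPrec] hands its step the counter, the value so far and then the parameters, which dictates the
    order of the arguments of [s]. *)
Lemma crec_iteri k (n b : seq nat -> nat) (s : nat -> nat -> seq nat -> nat) :
  crec k n -> crec k b ->
  crec k.+2 (fun w => s (nth 0 w 0) (nth 0 w 1) (drop 2 w)) ->
  crec k (fun v => iteri (n v) (fun i r => s i r v) (b v)).
Proof.
move=> cn [pb pbP] [ps psP].
pose f w := iteri (head 0 w) (fun i r => s i r (behead w)) (b (behead w)).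
apply: (@crec_comp k k.+1 f (fun v => n v :: v)) => [v /= -> // | | ].
  exists (PPrec pb ps) => [] [//|m v] [vk]; rewrite /f /=.
  elim: m => [|m IHm] /=; first by apply/ePrec0/pbP.
  apply: (ePrecS IHm); have := psP [:: m, iteri m (fun i r => s i r v) (b v) & v].
  by rewrite /= drop0; apply; rewrite vk.
by apply: crecs_cons => //; apply: crecs_id.
Qed.

Lemma crec_mu k f h : crec k.+1 f ->
  (forall v, size v = k ->
     f (h v :: v) = 0 /\ forall j, j < h v -> f (j :: v) <> 0) ->
  crec k h.
Proof.
move=> [p pP] hP; exists (PMu p) => v vk; have [fh fj] := hP v vk.
apply: eMu => [|j jh]; first by rewrite -fh; apply: pP; rewrite /= vk.
exists (f (j :: v)).-1; rewrite prednK ?lt0n; last exact/eqP/fj.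
by apply: pP; rewrite /= vk.
Qed.

Ltac crec_nth := solve [apply: crec_proj => // |
  apply: (@eq_crec _ (fun w => nth 0 w _)); [move=> ? _; rewrite nth_drop; reflexivity |
    apply: crec_proj => //]].

Lemma crec_add k f g : crec k f -> crec k g -> crec k (fun v => f v + g v).
Proof.
apply: crec_comp2; apply: (@eq_crec _ (fun v => iteri (nth 0 v 0) (fun _ r => r.+1) (nth 0 v 1))).
  by move=> v _; elim: (nth 0 v 0) => //= n ->.
by apply: crec_iteri; [crec_nth | crec_nth | apply/crec_succ; crec_nth].
Qed.

Lemma crec_pred k f : crec k f -> crec k (fun v => (f v).-1).
Proof.
apply: (@crec_comp1 predn); apply: (@eq_crec _ (fun v => iteri (nth 0 v 0) (fun i _ => i) 0)).
  by move=> v _; case: (nth 0 v 0).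
by apply: crec_iteri; [crec_nth | apply: crec_const | crec_nth].
Qed.

Lemma crec_sub k f g : crec k f -> crec k g -> crec k (fun v => f v - g v).
Proof.
apply: crec_comp2; apply: (@eq_crec _ (fun v => iteri (nth 0 v 1) (fun _ r => r.-1) (nth 0 v 0))).
  by move=> v _; elim: (nth 0 v 1) => [|n] /=; rewrite ?subn0 // subnS => ->.
by apply: crec_iteri; [crec_nth | crec_nth | apply/crec_pred; crec_nth].
Qed.

Lemma crec_mul k f g : crec k f -> crec k g -> crec k (fun v => f v * g v).
Proof.
apply: crec_comp2; apply: (@eq_crec _ (fun v => iteri (nth 0 v 0) (fun _ r => nth 0 v 1 + r) 0)).
  by move=> v _; elim: (nth 0 v 0) => //= n ->; rewrite mulSn.
apply: (@crec_iteri 2 _ _ (fun i r v => nth 0 v 1 + r));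
  [crec_nth | apply: crec_const | apply/crec_add; crec_nth].
Qed.

Lemma crec_odd k f : crec k f -> crec k (fun v => odd (f v)).
Proof.
apply: (@crec_comp1 (fun n => odd n : nat)).
apply: (@eq_crec _ (fun v => iteri (nth 0 v 0) (fun _ r => 1 - r) 0)).
  by move=> v _; elim: (nth 0 v 0) => //= n ->; case: odd.
apply: (@crec_iteri 1 _ _ (fun i r v => 1 - r));
  [crec_nth | apply: crec_const | apply/crec_sub; [apply: crec_const | crec_nth]].
Qed.

Lemma crec_half k f : crec k f -> crec k (fun v => (f v)./2).
Proof.
(* With halves rounded down, (n+1)/2 = n - n/2. *)
apply: (@crec_comp1 half); apply: (@eq_crec _ (fun v => iteri (nth 0 v 0) (fun i r => i - r) 0)).
  by move=> v _; elim: (nth 0 v 0) => [|n] //= ->; lia.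
by apply: (@crec_iteri 1 _ _ (fun i r v => i - r));
  [crec_nth | apply: crec_const | apply/crec_sub; crec_nth].
Qed.

(* [CodeSeq.code (x :: s) = consc x (code s)] *)
Definition consc x m := 2 ^ x * m.*2.+1.
(** For n > 0 this is the exponent of 2 in n; [tailc] removes that power of 2 and then the last bit
    of the odd cofactor. *)
Definition headc n := if n is 0 then 0 else head 0 (CodeSeq.decode n).
Definition tailc n := iter (headc n).+1 half n.

Lemma iter_half_exp x m : iter x half (2 ^ x * m) = m.
Proof.
elim: x m => [|x IHx] m; first by rewrite mul1n.
by rewrite iterSr expnS -mulnA mul2n doubleK IHx.
Qed.

Lemma headc_consc x s : headc (consc x (CodeSeq.code s)) = x.
Proof.
have E := CodeSeq.codeK (x :: s); rewrite /= -/(consc x (CodeSeq.code s)) in E.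
by rewrite /headc; case: consc E => [|n ->].
Qed.

Lemma tailc_consc x s : tailc (consc x (CodeSeq.code s)) = CodeSeq.code s.
Proof. by rewrite /tailc headc_consc /= iter_half_exp /= uphalf_double. Qed.

Lemma conscP n : n != 0 -> n = consc (headc n) (tailc n).
Proof.
rewrite -{1 2}(CodeSeq.decodeK n); case E: (CodeSeq.decode n) => [|x s] //= _.
have -> : n = consc x (CodeSeq.code s) by rewrite -(CodeSeq.decodeK n) E.
by rewrite headc_consc tailc_consc.
Qed.

Lemma crec_iter_half k f g : crec k f -> crec k g ->
  crec k (fun v => iter (f v) half (g v)).
Proof.
apply: (@crec_comp2 (fun n m => iter n half m)).
apply: (@eq_crec _ (fun v => iteri (nth 0 v 0) (fun i r => r./2) (nth 0 v 1))).
  by move=> v _; elim: (nth 0 v 0) => //= n ->.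
by apply: (@crec_iteri 2 _ _ (fun i r v => r./2));
  [crec_nth | crec_nth | apply/crec_half; crec_nth].
Qed.

Lemma crec_headc k f : crec k f -> crec k (fun v => headc (f v)).
Proof.
apply: (@crec_comp1 headc).
(* The search finds the first j with n / 2^j odd; the last summand stops it at once for n = 0, where
   no such j exists. *)
apply: (@crec_mu _ (fun v => 1 - (odd (iter (nth 0 v 0) half (nth 0 v 1)) + (1 - nth 0 v 1)))).
  by apply: crec_sub; [apply: crec_const | apply: crec_add;
    [apply/crec_odd/crec_iter_half | apply: crec_sub; first exact: crec_const]; crec_nth].
move=> v _ /=; have [->|n0] := eqVneq (nth 0 v 0) 0; first by split.
move: (nth 0 v 0) n0 => n n0.
move: (conscP n0) (n0); rewrite /consc; move: (headc n) (tailc n) => x m -> {n}n0.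
rewrite -lt0n in n0; rewrite (eqP (n0 : 1 - _ == 0)).
split=> [|j jx]; first by rewrite iter_half_exp /= odd_double.
rewrite -(subnKC jx) addSnnS expnD -mulnA iter_half_exp.
by rewrite expnS -mulnA mul2n odd_double.
Qed.

Lemma crec_tailc k f : crec k f -> crec k (fun v => tailc (f v)).
Proof.
apply: (@crec_comp1 tailc); apply: crec_iter_half; last crec_nth.
by apply/crec_succ/crec_headc; crec_nth.
Qed.

Lemma crec_consc k f g : crec k f -> crec k g -> crec k (fun v => consc (f v) (g v)).
Proof.
apply: (@crec_comp2 consc).
apply: (@eq_crec _ (fun v => iteri (nth 0 v 0) (fun i r => r + r) (nth 0 v 1 + nth 0 v 1).+1)).
  move=> v _; rewrite addnn /consc; elim: (nth 0 v 0) => [|n IH] /=; first by rewrite mul1n.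
  by rewrite IH addnn -mul2n mulnA expnS.
apply: (@crec_iteri 2 _ _ (fun i r v => r + r)); first crec_nth.
  by apply/crec_succ/crec_add; crec_nth.
by apply: crec_add; crec_nth.
Qed.

Lemma crec_eq k f g : crec k f -> crec k g -> crec k (fun v => (f v == g v)).
Proof.
move=> cf cg.
apply: (@eq_crec _ (fun v => 1 - ((f v - g v) + (g v - f v)))).
  by move=> v _; case: eqP; lia.
by apply/crec_sub/crec_add; [apply: crec_const | apply: crec_sub..].
Qed.

(** * Computable functions between countable types *)

Definition computable (A B : countType) (f : A -> B) : Prop :=
  exists p, forall a, eval p [:: pickle a] (pickle (f a)).

Lemma eq_computable (A B : countType) (f g : A -> B) : f =1 g -> computable f -> computable g.
Proof. by move=> fg [p pP]; exists p => a; rewrite -fg. Qed.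

(** Programs see only codes, so a value may be replaced by one of another type with the same code.
    This opens up the encodings of integers and of finite functions. *)
Lemma comp_recode (X A B : countType) (f : X -> A) (g : X -> B) :
  (forall x, pickle (f x) = pickle (g x)) -> computable f -> computable g.
Proof. by move=> fg [p pP]; exists p => a; rewrite -fg. Qed.

Lemma comp_id (X : countType) : computable (fun x : X => x).
Proof. by exists (PProj 0) => x; apply: eProj. Qed.

Lemma comp_const (X A : countType) (a : A) : computable (fun _ : X => a).
Proof. by have [p pP] := @crec_const 1 (pickle a); exists p => x; apply: pP. Qed.

Lemma comp_crec1 (X A B : countType) F (f : X -> A) (h : X -> B) :
  crec 1 F -> (forall x, F [:: pickle (f x)] = pickle (h x)) ->
  computable f -> computable h.
Proof.
move=> [q qP] Fh [p pP]; exists (PComp q [:: p]) => x.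
rewrite -Fh; apply: eComp (qP _ _) => //.
by apply: eCons; [apply: pP | apply: eNil].
Qed.

Lemma comp_crec2 (X A B C : countType) F
    (f : X -> A) (g : X -> B) (h : X -> C) :
  crec 2 F -> (forall x, F [:: pickle (f x); pickle (g x)] = pickle (h x)) ->
  computable f -> computable g -> computable h.
Proof.
move=> [q qP] Fh [p pP] [p' pP']; exists (PComp q [:: p; p']) => x.
rewrite -Fh; apply: eComp (qP _ _) => //.
by apply: eCons; [apply: pP | apply: eCons; [apply: pP' | apply: eNil]].
Qed.

Lemma comp_comp (X A B : countType) (g : A -> B) (f : X -> A) :
  computable g -> computable f -> computable (fun x => g (f x)).
Proof.
move=> [q qP] [p pP]; exists (PComp q [:: p]) => x.
by apply: eComp (qP _); apply: eCons; [apply: pP | apply: eNil].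
Qed.

Lemma comp_cons (X A : countType) (f : X -> A) (g : X -> seq A) :
  computable f -> computable g -> computable (fun x => f x :: g x).
Proof.
apply: (@comp_crec2 _ _ _ _ (fun v => consc (nth 0 v 0) (nth 0 v 1))) => //.
by apply: crec_consc; crec_nth.
Qed.

(** A pair has the code of the two-element list of the codes of its components. *)
Lemma comp_pair (X A B : countType) (f : X -> A) (g : X -> B) :
  computable f -> computable g -> computable (fun x => (f x, g x)).
Proof.
apply: (@comp_crec2 _ _ _ _ (fun v => consc (nth 0 v 0) (consc (nth 0 v 1) 0))) => //.
by apply/crec_consc/crec_consc; [crec_nth | crec_nth | apply: crec_const].
Qed.

Lemma comp_fst (X A B : countType) (f : X -> A * B) :
  computable f -> computable (fun x => (f x).1).
Proof.
apply: (@comp_crec1 _ _ _ (fun v => headc (nth 0 v 0))) => [|x /=].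
  by apply: crec_headc; crec_nth.
by case: (f x) => a b; apply: (headc_consc _ [:: _]).
Qed.

Lemma comp_snd (X A B : countType) (f : X -> A * B) :
  computable f -> computable (fun x => (f x).2).
Proof.
apply: (@comp_crec1 _ _ _ (fun v => headc (tailc (nth 0 v 0)))) => [|x /=].
  by apply/crec_headc/crec_tailc; crec_nth.
by case: (f x) => a b; rewrite (tailc_consc _ [:: _]) (headc_consc _ [::]).
Qed.

Lemma comp_eqb (X A : countType) (f g : X -> A) :
  computable f -> computable g -> computable (fun x => f x == g x).
Proof.
apply: (@comp_crec2 _ _ _ _ (fun v => nth 0 v 0 == nth 0 v 1 : nat)) => [|x /=].
  by apply: crec_eq; crec_nth.
by rewrite (inj_eq (pcan_inj pickleK)).
Qed.

(** Both branches are total, so both are evaluated and one is selected as b f + (1 - b) g. *)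
Lemma comp_if (X A : countType) b (f g : X -> A) :
  computable b -> computable f -> computable g -> computable (fun x => if b x then f x else g x).
Proof.
have [q qP] : crec 3 (fun v => nth 0 v 0 * nth 0 v 1 + (1 - nth 0 v 0) * nth 0 v 2).
  apply: crec_add; apply: crec_mul; try crec_nth.
  by apply: crec_sub; [apply: crec_const | crec_nth].
move=> [pb bP] [pf fP] [pg gP]; exists (PComp q [:: pb; pf; pg]) => x.
have := qP [:: pickle (b x); pickle (f x); pickle (g x)] erefl.
have -> : pickle (b x) = b x by [].
rewrite /=; case: (b x) (bP x) => /=; rewrite ?mul1n ?mul0n ?addn0 ?add0n => Hb Hq;
 by apply: eComp Hq; do 3!apply: eCons => //; apply: eNil.
Qed.

Lemma comp_iteri (X B : countType) n b (s : X -> nat -> B -> B) :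
  computable n -> computable b -> computable (fun p : X * (nat * B) => s p.1 p.2.1 p.2.2) ->
  computable (fun x => iteri (n x) (s x) (b x)).
Proof.
(* Repacks counter, value and parameter into the code of the triple that the step function takes. *)
have [q qP] : crec 3 (fun v =>
    consc (nth 0 v 2) (consc (consc (nth 0 v 0) (consc (nth 0 v 1) 0)) 0)).
  by do !apply: crec_consc; solve [crec_nth | apply: crec_const].
move=> [pn nP] [pb bP] [ps sP].
exists (PComp (PPrec pb (PComp ps [:: q])) [:: pn; PProj 0]) => x.
apply: (@eComp _ _ _ [:: pickle (n x); pickle x]).
  by apply: eCons => //; apply: eCons; [apply: eProj | apply: eNil].
have -> : pickle (n x) = n x by [].
elim: (n x) => [|k IHk] /=; first exact: ePrec0.
apply: (ePrecS IHk); apply: eComp (sP (x, (k, iteri k (s x) (b x)))).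
by apply: eCons; [apply: qP | apply: eNil].
Qed.

(* A program for [f] may diverge on numbers that are not codes, so it must not be
   evaluated when [l x] is empty: [PPrec] on the truncated code, 0 or 1, ensures it. *)
Lemma comp_seq_case (X A B : countType) (l : X -> seq A)
    (f : X -> A -> seq A -> B) (g : X -> B) :
  computable l -> computable (fun p : X * (A * seq A) => f p.1 p.2.1 p.2.2) -> computable g ->
  computable (fun x => if l x is a :: s then f x a s else g x).
Proof.
have [q qP] : crec 2 (fun v => consc (nth 0 v 1)
   (consc (consc (headc (nth 0 v 0)) (consc (tailc (nth 0 v 0)) 0)) 0)).
  by repeat first [crec_nth | apply: crec_const | apply: crec_consc
    | apply: crec_headc | apply: crec_tailc].
have [t tP] : crec 1 (fun v => 1 - (1 - nth 0 v 0)).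
  by do 2!(apply: crec_sub; first exact: crec_const); crec_nth.
move=> [pl lP] [pf fP] [pg gP].
exists (PComp (PPrec pg (PComp pf [:: PComp q [:: PComp pl [:: PProj 2]; PProj 2]]))
  [:: PComp t [:: pl]; PProj 0]) => x.
apply: (@eComp _ _ _ [:: 1 - (1 - pickle (l x)); pickle x]).
  apply: eCons; last by apply: eCons; [apply: eProj | apply: eNil].
  by apply: eComp (tP [:: _] erefl); apply: eCons => //; apply: eNil.
have := lP x; case El: (l x) => [|a s] lx; first exact/ePrec0/gP.
have -> : 1 - (1 - pickle (a :: s)) = 1.
  have : 0 < pickle (a :: s) by rewrite /pickle /= muln_gt0 expn_gt0.
  lia.
apply: ePrecS (ePrec0 _ (gP x)) _.
apply: eComp (fP (x, (a, s))); apply: eCons; last exact: eNil.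
have := qP [:: pickle (a :: s); pickle x] erefl; rewrite /=.
rewrite [pickle (a :: s)]/= -/(consc (pickle a) (CodeSeq.code (map pickle s))).
rewrite headc_consc tailc_consc; apply: eComp.
apply: eCons; first by apply: eComp lx; apply: eCons; [apply: eProj | apply: eNil].
by apply: eCons; [apply: eProj | apply: eNil].
Qed.

(** Existence only guarantees that the search by [PMu] ends, so it may be proved classically. *)
Lemma comp_ex_minn (X : countType) (P : X -> nat -> bool)
    (exP : forall x, exists c, P x c) :
  computable (fun p : X * nat => P p.1 p.2) -> computable (fun x => ex_minn (exP x)).
Proof.
have [q qP] : crec 2 (fun v => consc (nth 0 v 1) (consc (nth 0 v 0) 0)).
  by apply/crec_consc/crec_consc; [crec_nth | crec_nth | apply: crec_const].
have [t tP] : crec 1 (fun v => 1 - nth 0 v 0).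
  by apply: crec_sub; [apply: crec_const | crec_nth].
move=> [p pP]; exists (PMu (PComp t [:: PComp p [:: q]])) => x.
have E c : eval (PComp t [:: PComp p [:: q]]) [:: c; pickle x] (1 - P x c).
  have := tP [:: P x c : nat] erefl; apply: eComp; apply: eCons; last exact: eNil.
  by apply: eComp (pP (x, c)); apply: eCons; [apply: qP | apply: eNil].
case: ex_minnP => k Pk kmin; apply: eMu => [|j jk]; first by have := E k; rewrite Pk.
exists 0; have := E j; case: (boolP (P x j)) => // /kmin kj.
by have := leq_trans (jk : j < k) kj; rewrite ltnn.
Qed.

(** The code of a list can thus serve as the number of rounds of a fold, before the length is known
    to be computable. *)
Lemma size_code s : size s <= CodeSeq.code s.
Proof.
elim: s => //= x s; have := expn_gt0 2 x; move: (2 ^ x) (CodeSeq.code s) => u c.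
by move=> u0 sc; apply: leq_trans (leq_pmull _ u0); lia.
Qed.

(** A fold is an iteration on pairs of remaining list and accumulator. Rounds after the list is
    exhausted change nothing, so an upper bound on their number is enough. *)
Lemma comp_foldl (X A B : countType) (s : X -> B -> A -> B) b l :
  computable (fun p : X * (B * A) => s p.1 p.2.1 p.2.2) -> computable b -> computable l ->
  computable (fun x => foldl (s x) (b x) (l x)).
Proof.
move=> cs cb cl.
pose step x (st : seq A * B) := if st.1 is a :: t then (t, s x st.2 a) else st.
have E x k t c : iteri k (fun _ => step x) (t, c)
    = (drop k t, foldl (s x) c (take k t)).
  elim: k t c => [|k IHk] t c; first by rewrite drop0 take0.
  have -> : iteri k.+1 (fun _ => step x) (t, c) =
            iteri k (fun _ => step x) (step x (t, c)).
    by elim: (k) => //= i <-.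
  by case: t => [|a t] /=; rewrite IHk.
apply: (@eq_computable _ _ (fun x =>
  (iteri (pickle (l x)) (fun _ => step x) (l x, b x)).2)) => [x|].
  rewrite E /= take_oversize //.
  by rewrite -(size_map pickle); apply: size_code.
apply: comp_snd.
apply: (@comp_iteri _ _ _ _ (fun x _ => step x)).
- exact: (comp_recode _ cl).
- exact: comp_pair.
rewrite /step; apply: (@comp_seq_case _ _ _ _ (fun p a t => (t, s p.1 p.2.2.2 a))).
- exact/comp_fst/comp_snd/comp_snd/comp_id.
- apply: comp_pair; first exact/comp_snd/comp_snd/comp_id.
  apply: (comp_comp (f := fun q : X * (nat * (seq A * B)) * (A * seq A) =>
    (q.1.1, (q.1.2.2.2, q.2.1))) cs).
  apply: comp_pair; first exact/comp_fst/comp_fst/comp_id.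
  apply: comp_pair; last exact/comp_fst/comp_snd/comp_id.
  exact/comp_snd/comp_snd/comp_snd/comp_fst/comp_id.
- exact/comp_snd/comp_snd/comp_id.
Qed.

Lemma comp_rev (X A : countType) (l : X -> seq A) :
  computable l -> computable (fun x => rev (l x)).
Proof.
move=> cl; apply: (@eq_computable _ _ (fun x => foldl (fun s a => a :: s) [::] (l x))).
  by move=> x; rewrite -[RHS]cats0 -catrevE; elim: (l x) [::] => //= a s IHs t.
apply: (@comp_foldl _ _ _ (fun _ s a => a :: s)) => //; last exact: comp_const.
by apply: comp_cons; [exact/comp_snd/comp_snd/comp_id | exact/comp_fst/comp_snd/comp_id].
Qed.

Lemma comp_foldr (X A B : countType) (s : X -> A -> B -> B) b l :
  computable (fun p : X * (A * B) => s p.1 p.2.1 p.2.2) -> computable b -> computable l ->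
  computable (fun x => foldr (s x) (b x) (l x)).
Proof.
move=> cs cb cl.
apply: (@eq_computable _ _ (fun x => foldl (fun c a => s x a c) (b x) (rev (l x)))).
  by move=> x; rewrite foldl_rev.
apply: (@comp_foldl _ _ _ (fun x c a => s x a c)) => //; last exact: comp_rev.
apply: (comp_comp (f := fun p : X * (B * A) => (p.1, (p.2.2, p.2.1))) cs).
apply: comp_pair; first exact/comp_fst/comp_id.
by apply: comp_pair; [exact/comp_snd/comp_snd/comp_id | exact/comp_fst/comp_snd/comp_id].
Qed.

Ltac comp_step0 := first [ assumption | exact: comp_id | apply: comp_const
  | exact: (comp_fst (comp_id _)) | exact: (comp_snd (comp_id _))
  | match goal with
    | |- computable (fun x => ((@?f x), (@?g x))) => apply: comp_pair
    | |- computable (fun x => fst (@?f x)) => apply: comp_fst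
    | |- computable (fun x => snd (@?f x)) => apply: comp_snd
    | |- computable (fun x => (@?f x) :: (@?g x)) => apply: comp_cons
    | |- computable (fun x => (@?f x) == (@?g x)) => apply: comp_eqb
    | |- computable (fun x => foldr (@?f x) (@?g x) (@?h x)) => apply: comp_foldr
    end
  | match goal with |- computable ?h =>
      match h with context [if _ then _ else _] => apply: comp_if end end ].
Ltac comp_step := comp_step0.
Ltac auto_comp := cbv beta; solve [repeat (comp_step; cbv beta)].

Lemma comp_app1 (X A B : countType) (g : A -> B) (f : X -> A) :
  computable (fun a => g a) -> computable f -> computable (fun x => g (f x)).
Proof. exact: comp_comp. Qed.

Lemma comp_app2 (X A B C : countType) (h : A -> B -> C) (f : X -> A) (g : X -> B) :
  computable (fun p : A * B => h p.1 p.2) -> computable f -> computable g ->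
  computable (fun x => h (f x) (g x)).
Proof. by move=> ch cf cg; apply: (comp_comp ch (comp_pair cf cg)). Qed.

Lemma comp_crecn1 (X : countType) F (f : X -> nat) :
  crec 1 (fun v => F (nth 0 v 0)) -> computable f -> computable (fun x => F (f x)).
Proof. by move=> cF; apply: (comp_crec1 cF). Qed.

Lemma comp_crecn2 (X : countType) F (f g : X -> nat) :
  crec 2 (fun v => F (nth 0 v 0) (nth 0 v 1)) ->
  computable f -> computable g -> computable (fun x => F (f x) (g x)).
Proof. by move=> cF; apply: (comp_crec2 cF). Qed.

(** * Computable arithmetic and Boolean operations *)

Section Nat.
Variables (X : countType) (f g : X -> nat).
Hypotheses (cf : computable f) (cg : computable g).

Lemma comp_succn : computable (fun x => (f x).+1).
Proof. by apply: comp_crecn1 cf; apply: crec_succ; crec_nth. Qed.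
Lemma comp_predn : computable (fun x => (f x).-1).
Proof. by apply: comp_crecn1 cf; apply: crec_pred; crec_nth. Qed.
Lemma comp_half : computable (fun x => (f x)./2).
Proof. by apply: comp_crecn1 cf; apply: crec_half; crec_nth. Qed.
Lemma comp_addn : computable (fun x => f x + g x).
Proof. by apply: comp_crecn2 cf cg; apply: crec_add; crec_nth. Qed.
Lemma comp_subn : computable (fun x => f x - g x).
Proof. by apply: comp_crecn2 cf cg; apply: crec_sub; crec_nth. Qed.
Lemma comp_muln : computable (fun x => f x * g x).
Proof. by apply: comp_crecn2 cf cg; apply: crec_mul; crec_nth. Qed.
Lemma comp_leq : computable (fun x => f x <= g x).
Proof. by rewrite /leq; apply: comp_eqb; [apply: comp_subn | apply: comp_const]. Qed.

End Nat.

Section Bool.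
Variables (X : countType) (f g : X -> bool).
Hypotheses (cf : computable f) (cg : computable g).

Lemma comp_andb : computable (fun x => f x && g x).
Proof. by rewrite /andb; auto_comp. Qed.
Lemma comp_orb : computable (fun x => f x || g x).
Proof. by rewrite /orb; auto_comp. Qed.
Lemma comp_negb : computable (fun x => ~~ f x).
Proof. by rewrite /negb; auto_comp. Qed.

End Bool.

Ltac comp_step1 := first [ comp_step0
  | match goal with
    | |- computable (fun x => S (@?f x)) => apply: comp_succn
    | |- computable (fun x => predn (@?f x)) => apply: comp_predn
    | |- computable (fun x => half (@?f x)) => apply: comp_half
    | |- computable (fun x => addn (@?f x) (@?g x)) => apply: comp_addn
    | |- computable (fun x => subn (@?f x) (@?g x)) => apply: comp_subn
    | |- computable (fun x => muln (@?f x) (@?g x)) => apply: comp_muln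
    | |- computable (fun x => leq (@?f x) (@?g x)) => apply: comp_leq
    | |- computable (fun x => andb (@?f x) (@?g x)) => apply: comp_andb
    | |- computable (fun x => orb (@?f x) (@?g x)) => apply: comp_orb
    | |- computable (fun x => negb (@?f x)) => apply: comp_negb
    end ].
Ltac comp_step ::= comp_step1.

(** The remainder is found by counting up to m and resetting at d. For d = 0 no reset occurs, in
    agreement with m mod 0 = m. *)
Lemma comp_dvdn (X : countType) (f g : X -> nat) :
  computable f -> computable g -> computable (fun x => f x %| g x).
Proof.
apply: (@comp_app2 _ _ _ _ (fun d m => d %| m)).
apply: (@eq_computable _ _ (fun p : nat * nat =>
  iteri p.2 (fun _ r => if r.+1 == p.1 then 0 else r.+1) 0 == 0)).
  move=> [d m] /=; rewrite /dvdn; congr (_ == _).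
  elim: m => [|m IHm] /=; first by rewrite mod0n.
  rewrite {}IHm; case: d => [|d]; first by rewrite !modn0.
  rewrite -(addn1 m) -[in RHS]modnDml addn1.
  have [->|md] := eqVneq; first by rewrite modnn.
  have lt_md : (m %% d.+1).+1 < d.+1 by rewrite ltn_neqAle md ltn_pmod.
  by rewrite [RHS]modn_small.
apply: comp_eqb; last auto_comp.
by apply: (@comp_iteri _ _ _ _ (fun p : nat * nat => fun _ r =>
  if r.+1 == p.1 then 0 else r.+1)); auto_comp.
Qed.

(** * Computable operations on lists *)

Lemma comp_map (X A B : countType) (f : X -> A -> B) l :
  computable (fun p : X * A => f p.1 p.2) -> computable l ->
  computable (fun x => map (f x) (l x)).
Proof.
move=> cf cl; apply: (@eq_computable _ _ (fun x => foldr (fun a s => f x a :: s) [::] (l x))).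
  by move=> x; elim: (l x) => //= a s ->.
apply: (@comp_foldr _ _ _ (fun x a s => f x a :: s)) => //; first apply: comp_cons; try auto_comp.
by apply: (@comp_app2 _ _ _ _ f) => //; auto_comp.
Qed.

Lemma comp_filter (X A : countType) (f : X -> A -> bool) l :
  computable (fun p : X * A => f p.1 p.2) -> computable l ->
  computable (fun x => filter (f x) (l x)).
Proof.
move=> cf cl; apply: (@eq_computable _ _ (fun x =>
  foldr (fun a s => if f x a then a :: s else s) [::] (l x))).
  by move=> x; elim: (l x) => //= a s ->.
apply: (@comp_foldr _ _ _ (fun x a s => if f x a then a :: s else s)) => //; last auto_comp.
apply: comp_if; try auto_comp.
by apply: (@comp_app2 _ _ _ _ f) => //; auto_comp.
Qed.

Lemma comp_all (X A : countType) (f : X -> A -> bool) l :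
  computable (fun p : X * A => f p.1 p.2) -> computable l ->
  computable (fun x => all (f x) (l x)).
Proof.
move=> cf cl; apply: (@eq_computable _ _ (fun x => foldr (fun a s => f x a && s) true (l x))).
  by move=> x; elim: (l x) => //= a s ->.
apply: (@comp_foldr _ _ _ (fun x a s => f x a && s)) => //; last auto_comp.
apply: comp_andb; last auto_comp.
by apply: (@comp_app2 _ _ _ _ f) => //; auto_comp.
Qed.

Lemma comp_has (X A : countType) (f : X -> A -> bool) l :
  computable (fun p : X * A => f p.1 p.2) -> computable l ->
  computable (fun x => has (f x) (l x)).
Proof.
move=> cf cl; apply: (@eq_computable _ _ (fun x => ~~ all (fun a => ~~ f x a) (l x))).
  by move=> x; rewrite all_predC negbK.
by apply/comp_negb/(@comp_all _ _ (fun x a => ~~ f x a)) => //; apply: comp_negb.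
Qed.

Lemma comp_cat (X A : countType) (s t : X -> seq A) :
  computable s -> computable t -> computable (fun x => s x ++ t x).
Proof.
move=> cs ct; apply: (@eq_computable _ _ (fun x => foldr cons (t x) (s x))).
  by move=> x; elim: (s x) => //= a l ->.
by apply: (@comp_foldr X A _ (fun (_ : X) (a : A) (l : seq A) => a :: l)) => //; auto_comp.
Qed.

Lemma comp_flatten (X A : countType) (s : X -> seq (seq A)) :
  computable s -> computable (fun x => flatten (s x)).
Proof.
move=> cs; apply: (@comp_foldr X (seq A) _ (fun (_ : X) (a l : seq A) => a ++ l)) => //;
  last auto_comp.
by cbv beta; apply: comp_cat; auto_comp.
Qed.

Lemma comp_size (X A : countType) (s : X -> seq A) :
  computable s -> computable (fun x => size (s x)).
Proof.
move=> cs; apply: (@eq_computable _ _ (fun x => foldr (fun _ n => n.+1) 0 (s x))).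
  by move=> x; elim: (s x) => //= a l ->.
by apply: (@comp_foldr _ _ _ (fun _ _ n => n.+1)) => //; auto_comp.
Qed.

Lemma comp_behead (X A : countType) (s : X -> seq A) :
  computable s -> computable (fun x => behead (s x)).
Proof.
by move=> cs; apply: (@comp_seq_case _ _ _ _ (fun _ _ t => t)) => //; auto_comp.
Qed.

Lemma comp_head (X A : countType) (d : X -> A) (s : X -> seq A) :
  computable d -> computable s -> computable (fun x => head (d x) (s x)).
Proof.
by move=> cd cs; apply: (@comp_seq_case _ _ _ _ (fun _ a _ => a)) => //; auto_comp.
Qed.

Lemma comp_drop (X A : countType) (n : X -> nat) (s : X -> seq A) :
  computable n -> computable s -> computable (fun x => drop (n x) (s x)).
Proof.
move=> cn cs; apply: (@eq_computable _ _ (fun x => iteri (n x) (fun _ => behead) (s x))).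
  by move=> x; elim: (n x) => [|k IHk] /=; rewrite ?drop0 // -add1n -drop_drop drop1 IHk.
by apply: (@comp_iteri _ _ _ _ (fun (_ : X) (_ : nat) (l : seq A) => behead l)) => //; cbv beta;
  apply: comp_behead; auto_comp.
Qed.

Lemma comp_nth (X A : countType) (d : X -> A) (s : X -> seq A) (n : X -> nat) :
  computable d -> computable s -> computable n ->
  computable (fun x => nth (d x) (s x) (n x)).
Proof.
move=> cd cs cn; apply: (@eq_computable _ _ (fun x => head (d x) (drop (n x) (s x)))).
  by move=> x; rewrite -nth0 nth_drop addn0.
by apply: comp_head => //; apply: comp_drop.
Qed.

Lemma comp_take (X A : countType) (n : X -> nat) (s : X -> seq A) :
  computable n -> computable s -> computable (fun x => take (n x) (s x)).
Proof.
move=> cn cs; apply: (@eq_computable _ _ (fun x => rev (drop (size (s x) - n x) (rev (s x))))).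
  move=> x; rewrite drop_rev revK.
  have [sn|ns] := leqP (size (s x)) (n x); last by rewrite subKn // ltnW.
  by rewrite (eqP sn) subn0 take_size take_oversize.
by apply/comp_rev/comp_drop; [apply: comp_subn => //; apply: comp_size | apply: comp_rev].
Qed.

Lemma comp_nseq (X A : countType) (n : X -> nat) (a : X -> A) :
  computable n -> computable a -> computable (fun x => nseq (n x) (a x)).
Proof.
move=> cn ca; apply: (@eq_computable _ _ (fun x => iteri (n x) (fun _ => cons (a x)) [::])).
  by move=> x; elim: (n x) => //= k ->.
apply: (@comp_iteri _ _ _ _ (fun x (_ : nat) (l : seq A) => a x :: l)) => //; first auto_comp.
cbv beta; apply: comp_cons; [apply: (comp_app1 ca) | ]; auto_comp.
Qed.

Ltac comp_step2 := first [ comp_step1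
  | match goal with
    | |- computable (fun x => dvdn (@?f x) (@?g x)) => apply: comp_dvdn
    | |- computable (fun x => map (@?f x) (@?g x)) => apply: comp_map
    | |- computable (fun x => filter (@?f x) (@?g x)) => apply: comp_filter
    | |- computable (fun x => all (@?f x) (@?g x)) => apply: comp_all
    | |- computable (fun x => has (@?f x) (@?g x)) => apply: comp_has
    | |- computable (fun x => cat (@?f x) (@?g x)) => apply: comp_cat
    | |- computable (fun x => flatten (@?f x)) => apply: comp_flatten
    | |- computable (fun x => rev (@?f x)) => apply: comp_rev
    | |- computable (fun x => size (@?f x)) => apply: comp_size
    | |- computable (fun x => nth (@?f x) (@?g x) (@?h x)) => apply: comp_nth
    | |- computable (fun x => take (@?f x) (@?g x)) => apply: comp_take
    | |- computable (fun x => nseq (@?f x) (@?g x)) => apply: comp_nseq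
    | |- computable (fun x => head (@?f x) (@?g x)) => apply: comp_head
    end ].
Ltac comp_step ::= comp_step2.

(** * Computable arithmetic on integers and integer vectors *)

Section Int.
Local Open Scope ring_scope.

(** Integers are handled as differences of their positive and negative parts, which reduces their
    arithmetic to that of natural numbers. *)
Definition int_pos (z : int) : nat := if z is Posz n then n else 0.
Definition int_neg (z : int) : nat := if z is Negz n then n.+1 else 0.
Definition int_of_diff (p q : nat) : int := p%:Z - q%:Z.

Lemma int_posneg z : z = int_of_diff (int_pos z) (int_neg z).
Proof. by case: z => n; rewrite /int_of_diff /= ?subr0 ?NegzE ?sub0r. Qed.

(** An integer has the code of a pair of lists, [([:: n], [::])] for [Posz n] and [([::], [:: n])]
    for [Negz n], so its case can be read off after a recoding. *)
Lemma comp_int_pos (X : countType) (z : X -> int) :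
  computable z -> computable (fun x => int_pos (z x)).
Proof.
apply: comp_app1; pose f z : seq nat * seq nat :=
  match z with Posz n => ([:: n], [::]) | Negz n => ([::], [:: n]) end.
have cf : computable f by apply: (comp_recode _ (comp_id _)) => -[] n.
apply: (@eq_computable _ _ (fun z => head 0%N (f z).1)); first by case.
by apply: comp_head; auto_comp.
Qed.

Lemma comp_int_neg (X : countType) (z : X -> int) :
  computable z -> computable (fun x => int_neg (z x)).
Proof.
apply: comp_app1; pose f z : seq nat * seq nat :=
  match z with Posz n => ([:: n], [::]) | Negz n => ([::], [:: n.+1]) end.
have cf : computable f.
  pose g z : seq nat * seq nat :=
    match z with Posz n => ([:: n], [::]) | Negz n => ([::], [:: n]) end.
  have cg : computable g by apply: (comp_recode _ (comp_id _)) => -[] n.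
  apply: (@eq_computable _ _ (fun z => ((g z).1, map S (g z).2))) => [[]//|].
  auto_comp.
apply: (@eq_computable _ _ (fun z => head 0%N (f z).2)); first by case.
by apply: comp_head; auto_comp.
Qed.

Lemma comp_int_of_diff (X : countType) (p q : X -> nat) :
  computable p -> computable q -> computable (fun x => int_of_diff (p x) (q x)).
Proof.
apply: comp_app2; apply: (@comp_recode _ _ _ (fun p : nat * nat =>
  if (p.2 <= p.1)%N then ([:: (p.1 - p.2)%N], [::]) else ([::], [:: (p.2 - p.1).-1])
  : seq nat * seq nat)); last auto_comp.
move=> [a b] /=; case: leqP => ab; rewrite /int_of_diff; first by rewrite subzn.
by have -> : a%:Z - b%:Z = Negz (b - a).-1 by lia.
Qed.

Variables (X : countType) (f g : X -> int).
Hypotheses (cf : computable f) (cg : computable g).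

Lemma comp_opp : computable (fun x => - f x).
Proof.
apply: (@eq_computable _ _ (fun x => int_of_diff (int_neg (f x)) (int_pos (f x)))).
  by move=> x; rewrite {3}(int_posneg (f x)) /int_of_diff opprB.
by apply: comp_int_of_diff; [apply: comp_int_neg | apply: comp_int_pos].
Qed.

Lemma comp_add : computable (fun x => f x + g x).
Proof.
apply: (@eq_computable _ _ (fun x => int_of_diff
   (int_pos (f x) + int_pos (g x)) (int_neg (f x) + int_neg (g x)))).
  by move=> x; rewrite {3}(int_posneg (f x)) {3}(int_posneg (g x)) /int_of_diff; lia.
by apply: comp_int_of_diff; apply: comp_addn; solve [exact: comp_int_neg | exact: comp_int_pos].
Qed.

Lemma comp_mul : computable (fun x => f x * g x).
Proof.
apply: (@eq_computable _ _ (fun x => int_of_diff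
   (int_pos (f x) * int_pos (g x) + int_neg (f x) * int_neg (g x))
   (int_pos (f x) * int_neg (g x) + int_neg (f x) * int_pos (g x)))).
  move=> x; rewrite {5}(int_posneg (f x)) {5}(int_posneg (g x)) /int_of_diff.
  by rewrite !PoszD !PoszM; ring.
by apply: comp_int_of_diff; apply: comp_addn; apply: comp_muln;
  solve [exact: comp_int_neg | exact: comp_int_pos].
Qed.

Lemma comp_absz : computable (fun x => absz (f x)).
Proof.
apply: (@eq_computable _ _ (fun x => (int_pos (f x) + int_neg (f x))%N)).
  by move=> x; case: (f x) => n; rewrite //= addn0.
by apply: comp_addn; [apply: comp_int_pos | apply: comp_int_neg].
Qed.

End Int.

(** Makes the coordinates of a vector accessible to list operations. *)
Lemma pickle_ffun m (a : {ffun 'I_m -> int}) :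
  pickle a = pickle [seq (nat_of_ord i, a i) | i : 'I_m <- enum 'I_m].
Proof.
have E (s : seq 'I_m) : pickle [seq existT (fun _ : 'I_m => int) i (a i) | i <- s]
    = pickle [seq (nat_of_ord i, a i) | i <- s].
  by rewrite /pickle /= /pickle_seq; elim: s => //= i s ->.
exact: E.
Qed.

Lemma comp_ffun (X : countType) m (a : X -> {ffun 'I_m -> int}) :
  computable a -> computable (fun x => [seq (nat_of_ord i, a x i) | i : 'I_m <- enum 'I_m]).
Proof. by apply: comp_recode => x; apply: pickle_ffun. Qed.

Ltac comp_step3 := first [ comp_step2
  | match goal with
    | |- computable (fun x => GRing.add (@?f x) (@?g x)) => apply: comp_add
    | |- computable (fun x => GRing.opp (@?f x)) => apply: comp_opp
    | |- computable (fun x => GRing.mul (@?f x) (@?g x)) => apply: comp_mul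
    | |- computable (fun x => absz (@?f x)) => apply: comp_absz
    | |- computable (fun x => int_of_diff (@?f x) (@?g x)) => apply: comp_int_of_diff
    end ].
Ltac comp_step ::= comp_step3.

(** * Reduced words *)

Section Words.
Variable n : nat.
Implicit Types (x y : letter n) (s t u v w : seq (letter n)).

(** Left multiplication by a letter on reduced words, the step of the fold in [reduce]. *)
Definition push x s : seq (letter n) :=
  match s with
  | y :: t => if y == inv_letter x then t else x :: s
  | [::] => [:: x]
  end.

Lemma reduceE s : reduce s = foldr push [::] s. Proof. by []. Qed.

Definition invw s : seq (letter n) := rev (map (@inv_letter n) s).
Definition powerw s k : seq (letter n) := flatten (nseq k s).
Definition reduced : pred (seq (letter n)) :=
  sorted (fun x y => y != inv_letter x).

Lemma inv_letterK : involutive (@inv_letter n).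
Proof. by case=> b i; rewrite /inv_letter /= negbK. Qed.

Lemma invwK : involutive invw.
Proof.
by move=> s; rewrite /invw map_rev revK -map_comp map_id_in // => x _; exact: inv_letterK.
Qed.

Lemma invw_cat s t : invw (s ++ t) = invw t ++ invw s.
Proof. by rewrite /invw map_cat rev_cat. Qed.

Lemma invw_cons x s : invw (x :: s) = rcons (invw s) (inv_letter x).
Proof. by rewrite /invw /= rev_cons. Qed.

Lemma size_invw s : size (invw s) = size s.
Proof. by rewrite /invw size_rev size_map. Qed.

Lemma push_reduced x s : reduced s -> reduced (push x s).
Proof.
case: s => //= y t; case: eqP => [_ |/eqP yx]; first by case: t => //= z t /andP[].
by rewrite /reduced /= yx.
Qed.

Lemma reduced_reduce s : reduced (reduce s).
Proof. by elim: s => //= x s; apply: push_reduced. Qed.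

Lemma reduce_id s : reduced s -> reduce s = s.
Proof.
elim: s => // x s IHs rs; rewrite reduceE /= -reduceE IHs; last exact: path_sorted rs.
by case: s rs {IHs} => //= y s /andP[/negPf-> _].
Qed.

Lemma pushK x s : reduced s -> push x (push (inv_letter x) s) = s.
Proof.
case: s => [|y t] /=; first by rewrite eqxx.
rewrite inv_letterK; have [-> |_] := eqVneq y x; last by rewrite /= eqxx.
by case: t => //= z t /andP[/negPf->].
Qed.

(** Van der Waerden's argument: by [pushK] a letter and its inverse act on reduced words as inverse
    maps, so cancellations inside s do not change its action. *)
Lemma foldr_push_reduce s t : reduced t -> foldr push t s = foldr push t (reduce s).
Proof.
move=> rt; have rf r : reduced (foldr push t r) by elim: r => //= x r; apply: push_reduced.
elim: s => //= x s ->; rewrite -/(reduce s).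
case: (reduce s) => //= y r; have [->|//] := eqVneq y (inv_letter x).
exact: pushK.
Qed.

Lemma reduce_cat s t : reduce (s ++ t) = foldr push (reduce t) (reduce s).
Proof. by rewrite reduceE foldr_cat foldr_push_reduce // reduced_reduce. Qed.

Lemma reduceK s : reduce (reduce s) = reduce s.
Proof. exact/reduce_id/reduced_reduce. Qed.

Lemma reduce_catC s s' t t' : reduce s = reduce s' -> reduce t = reduce t' ->
  reduce (s ++ t) = reduce (s' ++ t').
Proof. by rewrite !reduce_cat => -> ->. Qed.

Lemma reduce_mid s t u v w : reduce s = reduce [::] ->
  u ++ s ++ v = w -> reduce w = reduce (u ++ v).
Proof.
move=> s0 <-; apply: reduce_catC => //.
by rewrite -[v in RHS]cat0s; apply: reduce_catC.
Qed.

Lemma reduce_cancel s u v : reduce s = [::] -> reduce (u ++ s ++ v) = reduce (u ++ v).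
Proof. by move=> s0; apply: (reduce_mid (s := s)). Qed.

Lemma reduce_invr s : reduce (s ++ invw s) = [::].
Proof.
elim: s => // x s IHs.
transitivity (reduce ([:: x] ++ (s ++ invw s) ++ [:: inv_letter x])).
  by rewrite invw_cons -cats1 /= catA.
by rewrite reduce_cancel //= eqxx.
Qed.

Lemma reduce_invl s : reduce (invw s ++ s) = [::].
Proof. by rewrite -[s in X in _ ++ X]invwK reduce_invr. Qed.

Lemma reduce_invw s t : reduce s = reduce t -> reduce (invw s) = reduce (invw t).
Proof.
move=> st; transitivity (reduce (invw s ++ t ++ invw t)).
  have := reduce_cancel (invw s) [::] (reduce_invr t).
  by rewrite !cats0 => ->.
rewrite catA -[RHS](reduce_cancel [::] (invw t) (reduce_invl s)) /=.
by apply: reduce_catC => //; apply: reduce_catC.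
Qed.

Lemma reduce_letterK v x : reduce ((v ++ [:: x]) ++ [:: inv_letter x]) = reduce v.
Proof.
rewrite -catA -[_ ++ [:: inv_letter x]]cats0.
by rewrite reduce_cancel ?cats0 // /= eqxx.
Qed.

Lemma powerwS s k : powerw s k.+1 = s ++ powerw s k. Proof. by []. Qed.

Lemma powerwD s k l : powerw s (k + l) = powerw s k ++ powerw s l.
Proof. by rewrite /powerw nseqD flatten_cat. Qed.

Lemma powerwM s k l : powerw s (k * l) = powerw (powerw s k) l.
Proof. by elim: l => [|l IHl]; rewrite ?muln0 // mulnS powerwD IHl. Qed.

Lemma powerw_reduce s t k : reduce s = reduce t -> reduce (powerw s k) = reduce (powerw t k).
Proof. by move=> st; elim: k => // k IHk; rewrite !powerwS; apply: reduce_catC. Qed.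

Lemma reduce_conj c r k :
  reduce (powerw (c ++ r ++ invw c) k) = reduce (c ++ powerw r k ++ invw c).
Proof.
elim: k => [|k IHk]; first by rewrite reduce_invr.
rewrite powerwS (reduce_catC (erefl _) IHk).
transitivity (reduce ((c ++ r) ++ (invw c ++ c) ++ (powerw r k ++ invw c))).
  by rewrite -!catA.
by rewrite reduce_cancel ?reduce_invl // powerwS -!catA.
Qed.

(** Being reduced concerns adjacent letters only, so an overlap of at least one letter suffices. *)
Lemma reduced_glue s x t u :
  reduced (s ++ x :: t) -> reduced (x :: t ++ u) -> reduced (s ++ x :: t ++ u).
Proof.
case: s => //= y s; rewrite /reduced /= !cat_path /= cat_path.
by move=> /and3P[-> -> _] /andP[-> ->].
Qed.

Lemma reduced_catl s t : reduced (s ++ t) -> reduced s.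
Proof. by case: s => //= x s; rewrite /reduced /= cat_path => /andP[]. Qed.

Lemma reduced_catr s t : reduced (s ++ t) -> reduced t.
Proof.
case: s => //= x s; rewrite /reduced /= cat_path => /andP[_].
exact: path_sorted.
Qed.

Lemma reduced_conj_power c r k : reduced (c ++ r ++ invw c) -> reduced (r ++ r) ->
  reduced (c ++ powerw r k.+1 ++ invw c).
Proof.
case: r => [|x r] rw rr.
  (* If r is empty, then c c^-1 is reduced but also reduces to the empty word, which forces c to be
     empty. *)
  have := reduce_id rw; rewrite /= reduce_invr => /(congr1 size).
  rewrite size_cat size_invw; case: (c) => //= _.
  by rewrite cats0; elim: k.
have rk : reduced (powerw (x :: r) k.+1 ++ invw c).
  elim: k => [|k IHk]; first by rewrite powerwS cats0; apply: reduced_catr rw.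
  rewrite powerwS [powerw _ _]powerwS -!catA cat_cons -cat_cons.
  by apply: reduced_glue; rewrite ?catA.
rewrite powerwS -catA cat_cons; apply: reduced_glue.
  by move: rw; rewrite catA => /reduced_catl.
by rewrite catA.
Qed.

(** As long as the first and the last letter are mutually inverse, they are moved into the
    conjugator c. Once they do not cancel, copies of r can be juxtaposed without cancellation. *)
Lemma cyclic_reduction w : reduced w -> exists c r,
  w = c ++ r ++ invw c /\ forall k, 0 < k -> reduced (c ++ powerw r k ++ invw c).
Proof.
move=> rw; suff [c [r [wE rr]]] : exists c r, w = c ++ r ++ invw c /\ reduced (r ++ r).
  exists c, r; split=> // -[//|k] _; apply: reduced_conj_power => //.
  by rewrite -wE.
have [m] := ubnP (size w); elim: m w rw => // m IHm [|x w] rw sw; first by exists [::], [::].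
case/lastP: w rw sw => [|w y] rw sw.
  (* A single letter is cyclically reduced because it differs from its inverse. *)
  exists [::], [:: x]; split=> //; rewrite /reduced /= andbT.
  by case: x {rw sw} => -[] i; apply/eqP=> -[].
have [xy|xy] := eqVneq x (inv_letter y).
  have [||c [r [-> rr]]] := IHm w.
  - by move: rw; rewrite -cats1 -cat1s => /reduced_catr /reduced_catl.
  - by move: sw; rewrite /= size_rcons; lia.
  exists (x :: c), r; split=> //.
  by rewrite invw_cons xy inv_letterK -!cats1 /= !catA.
exists [::], (x :: rcons w y); split; first by rewrite cats0.
move: rw; rewrite /reduced /= cat_path /= => ->.
by rewrite last_rcons xy.
Qed.

End Words.

(** * The subgroup generated by a finite set *)

Local Open Scope ring_scope.

Section Subgroup.
Variables (n m : nat).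
Local Notation word := (seq (letter n)).
Local Notation vec := {ffun 'I_m -> int}.
Implicit Types (gens : seq (elt n m)) (w : word) (a b : vec).

Definition signed_word (p : bool * elt n m) : word :=
  if p.1 then p.2.1 else invw p.2.1.
Definition signed_vec (p : bool * elt n m) : vec :=
  if p.1 then p.2.2 else - p.2.2.

Lemma foldr_mulG (s : seq (bool * elt n m)) :
  foldr (fun p acc => mulG (if p.1 then p.2 else invG p.2) acc) (oneG n m) s
  = (reduce (flatten (map signed_word s)), \sum_(p <- s) signed_vec p).
Proof.
elim: s => [|[e g] s IHs] /=.
  by rewrite big_nil; congr (_, _); apply/ffunP=> i; rewrite !ffunE.
rewrite {}IHs big_cons /mulG /=; congr (_, _).
  have -> : (if e then g else invG g).1 = signed_word (e, g) by case: e.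
  by apply: reduce_catC => //; apply: reduceK.
by apply/ffunP=> i; rewrite !ffunE /=; case: e; rewrite ?ffunE.
Qed.

Lemma in_genP gens w b : in_gen gens (w, b) <->
  exists2 s, all (fun p => p.2 \in gens) s &
    reduce (flatten (map signed_word s)) = reduce w
    /\ \sum_(p <- s) signed_vec p = b.
Proof.
split=> [[s [sg]]|[s sg [sw sb]]].
  by rewrite /eqG foldr_mulG /= reduceK => -[sw sb]; exists s.
by exists s; rewrite /eqG foldr_mulG /= reduceK.
Qed.

Lemma in_gen_eq gens w w' b : reduce w = reduce w' ->
  in_gen gens (w, b) -> in_gen gens (w', b).
Proof. by move=> ww' /in_genP[s sg sP]; apply/in_genP; exists s; rewrite -?ww'. Qed.

Lemma in_gen1 gens : in_gen gens ([::], 0).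
Proof. by apply/in_genP; exists [::]; rewrite ?big_nil. Qed.

Lemma in_genM gens w w' b b' : in_gen gens (w, b) -> in_gen gens (w', b') ->
  in_gen gens (w ++ w', b + b').
Proof.
move=> /in_genP[s sg [sw sb]] /in_genP[s' sg' [sw' sb']].
apply/in_genP; exists (s ++ s'); first by rewrite all_cat sg.
by rewrite map_cat flatten_cat big_cat /= sb sb'; split=> //; apply: reduce_catC.
Qed.

Lemma in_genV gens w b : in_gen gens (w, b) -> in_gen gens (invw w, - b).
Proof.
move=> /in_genP[s sg [sw sb]]; apply/in_genP.
exists (rev [seq (~~ p.1, p.2) | p <- s]); first by rewrite all_rev all_map.
split; last first.
  rewrite (perm_big _ (permEl (perm_rev _))) big_map -sb -sumrN.
  by apply: eq_bigr => -[[] g] _; rewrite /signed_vec //= opprK.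
rewrite -(reduce_invw sw); congr reduce.
elim: s {sg sw sb} => //= p s IHs; rewrite rev_cons map_rcons flatten_rcons IHs invw_cat.
by case: p => -[] g //=; rewrite /signed_word /= invwK.
Qed.

Lemma in_gen_gen gens g : g \in gens -> in_gen gens g.
Proof.
case: g => w b gg; apply/in_genP; exists [:: (true, (w, b))]; first by rewrite /= gg.
by rewrite /= cats0 big_seq1.
Qed.

Lemma in_genX gens w b k : in_gen gens (w, b) -> in_gen gens (powerw w k, b *+ k).
Proof.
move=> Hw; elim: k => [|k IHk]; first exact: in_gen1.
by rewrite powerwS mulrS; apply: in_genM.
Qed.

Lemma in_gen_expG gens w a k :
  in_gen gens (expG (w, a) k) <-> in_gen gens (powerw w k, a *+ k).
Proof.
have E : reduce (expG (w, a) k).1 = reduce (powerw w k) /\ (expG (w, a) k).2 = a *+ k.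
  elim: k => [|k [IH1 IH2]] /=; first by split=> //; apply/ffunP=> i; rewrite !ffunE.
  split; first by rewrite reduceK powerwS; apply: reduce_catC.
  by rewrite IH2 mulrS; apply/ffunP=> i; rewrite !ffunE.
by case: (expG _ _) E => w' a' /= [E ->]; split; apply: in_gen_eq.
Qed.

End Subgroup.

(* [((v, (e, i)), (z, v'))] is an edge of weight [z] from [v] to [v'] labelled by
   the letter [(e, i)]. *)
Definition edge : Type := ((nat * (bool * nat)) * (int * nat))%type.
Definition inv_edge (e : edge) : edge :=
  ((e.2.2, (~~ e.1.2.1, e.1.2.2)), (- e.2.1, e.1.1)).
(** Foldedness in the sense of Stallings. Weights belong to the edges, so a label and a starting
    vertex determine the weight of a walk as well as its end. *)
Definition folded (D : seq edge) : bool :=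
  all (fun e => all (fun e' => ~~ (e.1 == e'.1) || (e == e')) D
                && has (fun e' => inv_edge e == e') D) D.

(** * Walks in weighted automata *)

Section Graph.
Variables (n m : nat).
Local Notation word := (seq (letter n)).
Local Notation vec := {ffun 'I_m -> int}.

Definition label (x : letter n) : bool * nat := (x.1, nat_of_ord x.2).

(** All reachable pairs of vertex and weight are kept, since a list of edges met during a search
    need not be folded. *)
Definition run_step (D : seq edge) (st : seq (nat * int)) (x : letter n) :=
  flatten [seq [seq (e.2.2, s.2 + e.2.1) | e <- D & e.1 == (s.1, label x)] | s <- st].
Definition run D (w : word) := foldl (run_step D) [:: (0%N, 0)] w.

Fixpoint walk (D : seq edge) (w : word) (v v' : nat) (z : int) : Prop :=
  if w is x :: w' then
    exists e, [/\ e \in D, e.1 = (v, label x) & walk D w' e.2.2 v' (z - e.2.1)]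
  else v = v' /\ z = 0.

Lemma mem_run D w v z : (v, z) \in run D w <-> walk D w 0 v z.
Proof.
have E st : (v, z) \in foldl (run_step D) st w <->
    exists s, s \in st /\ walk D w s.1 v (z - s.2).
  elim: w st => [|x w IHw] st /=.
    split=> [vz|[[u y] [/= uy [uv /eqP]]]]; first by exists (v, z); rewrite subrr.
    by rewrite subr_eq0 -uv => /eqP->.
  rewrite IHw; split.
    move=> [s [/flatten_mapP[s0 s0st /mapP[e]]]].
    rewrite mem_filter => /andP[/eqP e1 eD] -> /= wlk.
    by exists s0; split=> //; exists e; split=> //; rewrite -addrA -opprD.
  move=> [s [sst [e [eD e1 wlk]]]]; exists (e.2.2, s.2 + e.2.1); split.
    apply/flatten_mapP; exists s => //; apply/mapP; exists e => //.
    by rewrite mem_filter e1 eqxx.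
  by rewrite /= opprD addrA.
rewrite E; split=> [[s []]|wlk]; first by rewrite inE => /eqP-> /=; rewrite subr0.
by exists (0%N, 0); rewrite subr0 inE eqxx.
Qed.

Lemma walk_cat D w1 w2 v v' z : walk D (w1 ++ w2) v v' z <->
  exists u y, walk D w1 v u y /\ walk D w2 u v' (z - y).
Proof.
elim: w1 v z => [|x w1 IHw] v z /=.
  split=> [wlk|[u [y [[-> ->]]]]]; last by rewrite subr0.
  by exists v, 0; rewrite subr0.
split=> [[e [eD e1 /IHw[u [y [w1P w2P]]]]]|[u [y [[e [eD e1 w1P]] w2P]]]].
  exists u, (y + e.2.1); split; first by exists e; rewrite addrK.
  by rewrite opprD addrA addrAC.
exists e; split=> //; apply/IHw; exists u, (y - e.2.1); split=> //.
by rewrite opprB addrA subrK.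
Qed.

Section Folded.
Variable D : seq edge.
Hypothesis fD : folded D.

Lemma folded_det e e' : e \in D -> e' \in D -> e.1 = e'.1 -> e = e'.
Proof.
move=> eD e'D ee'; have /andP[/allP/(_ e' e'D) + _] := allP fD e eD.
by rewrite ee' eqxx => /eqP.
Qed.

Lemma folded_inv e : e \in D -> inv_edge e \in D.
Proof. by move=> eD; have /andP[_ /hasP[e' e'D /eqP->]] := allP fD e eD. Qed.

Lemma walk_det w v v1 v2 z1 z2 :
  walk D w v v1 z1 -> walk D w v v2 z2 -> v1 = v2 /\ z1 = z2.
Proof.
elim: w v z1 z2 => [|x w IHw] v z1 z2 /=; first by move=> [<- ->] [<- ->].
move=> [e [eD e1 wlk]] [e' [e'D e'1]].
rewrite -(folded_det eD e'D) ?e1 // => /(IHw _ _ _ wlk)[-> /eqP].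
by rewrite (inj_eq (addIr _)) => /eqP->.
Qed.

Lemma walk_letter_inv x v v' z :
  walk D [:: x] v v' z -> walk D [:: inv_letter x] v' v (- z).
Proof.
move=> [e [eD e1 [<- /eqP]]]; rewrite subr_eq0 => /eqP->.
exists (inv_edge e); split; first exact: folded_inv.
  by rewrite /= e1.
by rewrite /= e1 subrr.
Qed.

Lemma walk_invw w v v' z : walk D w v v' z -> walk D (invw w) v' v (- z).
Proof.
elim: w v z => [|x w IHw] v z; first by move=> [-> ->]; rewrite oppr0.
rewrite -cat1s => /walk_cat[u [y [xP /IHw wP]]].
rewrite invw_cat; apply/walk_cat; exists u, (- (z - y)); split=> //.
by rewrite opprK [_ + (z - y)]addrC addrAC subrr sub0r; apply: walk_letter_inv.
Qed.

(** In a folded automaton a cancelling pair of letters runs along an edge and back, with opposite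
    weights. *)
Lemma walk_push x w v v' z : walk D (x :: w) v v' z -> walk D (push x w) v v' z.
Proof.
case: w => // y w; rewrite /push; case: eqP => // -> [e [eD e1 [e' [e'D e'1 wP]]]].
have ee' : e' = inv_edge e.
  by apply: folded_det => //; [apply: folded_inv | rewrite e'1 /= e1].
by move: wP; rewrite ee' /= e1 /= opprK subrK.
Qed.

Lemma walk_reduce w v v' z : walk D w v v' z -> walk D (reduce w) v v' z.
Proof.
elim: w v z => // x w IHw v z [e [eD e1 wP]].
by apply: walk_push; exists e; split=> //; apply: IHw.
Qed.

End Folded.

Definition dot (lam : seq int) (a : vec) : int := \sum_(i < m) lam`_i * a i.

Lemma dotD lam : {morph dot lam : a b / a + b}.
Proof.
by move=> a b; rewrite -big_split; apply: eq_bigr => i _; rewrite ffunE mulrDr.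
Qed.

Lemma dot0 lam : dot lam 0 = 0.
Proof. by rewrite /dot big1 // => i _; rewrite ffunE mulr0. Qed.

Lemma dotN lam : {morph dot lam : a / - a}.
Proof. by move=> a; apply/eqP; rewrite -addr_eq0 -dotD addNr dot0. Qed.

Lemma dotB lam : {morph dot lam : a b / a - b}.
Proof. by move=> a b; rewrite dotD dotN. Qed.

Lemma dotMn lam a k : dot lam (a *+ k) = dot lam a *+ k.
Proof. by elim: k => [|k IHk]; rewrite ?dot0 // !mulrS dotD IHk. Qed.

(** For M = 0 divisibility means equality, so congruences and exact weights are treated together. *)
Definition loop_ok (lam : seq int) (M : nat) (a : vec) (s : nat * int) : bool :=
  (s.1 == 0%N) && (M %| absz (s.2 - dot lam a)%R)%N.
Definition covers D lam M (gens : seq (elt n m)) : bool :=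
  folded D && all (fun g => has (loop_ok lam M g.2) (run D g.1)) gens.

(** Loops at 0 can be concatenated and inverted, with weights added and negated, so the test on
    generators extends to all products. [walk_reduce] passes from a product of generators to the
    reduced word it represents. *)
Lemma covers_walk D lam M gens w b : covers D lam M gens -> in_gen gens (w, b) ->
  exists2 z, walk D (reduce w) 0 0 z & (M%:Z %| z - dot lam b)%Z.
Proof.
move=> /andP[fD /allP gP] /in_genP[s sg [<- <-]] {w b}.
elim: s sg => [_|[e g] s IHs /= /andP[gg /IHs[z zP zM]]].
  by rewrite big_nil dot0; exists 0; rewrite //= subrr dvdz0.
have [y yP yM] : exists2 y, walk D (signed_word (e, g)) 0 0 y
    & (M%:Z %| y - dot lam (signed_vec (e, g)))%Z.
  have /hasP[[v y] /mem_run yP /andP[/= /eqP v0 yM]] := gP g gg.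
  rewrite v0 in yP; case: e; first by exists y.
  exists (- y); first exact: walk_invw.
  by rewrite /signed_vec /= dotN -opprD dvdzE abszN.
exists (y + z); last first.
  by rewrite big_cons dotD opprD addrACA; apply: rpredD.
rewrite (_ : reduce _ = reduce (signed_word (e, g) ++ reduce (flatten (map (@signed_word n m) s)))).
  apply: walk_reduce => //; apply/walk_cat; exists 0%N, y; split=> //.
  by rewrite [y + z]addrC addrK.
by apply: reduce_catC; rewrite ?reduceK.
Qed.

End Graph.

(** * Separating an integer vector from a subgroup *)

Section Lattice.
Variable m : nat.
Local Notation vec := {ffun 'I_m -> int}.

Definition subgroup (L : vec -> Prop) : Prop :=
  L 0 /\ forall a b, L a -> L b -> L (a - b).

Section Subgroup.
Variables (L : vec -> Prop) (sL : subgroup L).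
Lemma subgroupN a : L a -> L (- a).
Proof. by move=> La; rewrite -sub0r; apply: sL.2 => //; apply: sL.1. Qed.
Lemma subgroupD a b : L a -> L b -> L (a + b).
Proof. by move=> La Lb; rewrite -[b]opprK; apply: sL.2 => //; apply: subgroupN. Qed.
Lemma subgroupMn a k : L a -> L (a *+ k).
Proof.
by move=> La; elim: k => [|k IHk]; [apply: sL.1 | rewrite mulrS; apply: subgroupD].
Qed.
Lemma subgroupMz a (k : int) : L a -> L (a *~ k).
Proof.
move=> La; case: k => k; first exact: subgroupMn.
by rewrite NegzE mulrNz; apply/subgroupN/subgroupMn.
Qed.
End Subgroup.

Lemma ffunMz (a : vec) (k : int) i : (a *~ k) i = a i * k.
Proof.
have N (b : vec) (j : nat) : (b *+ j) i = b i *+ j.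
  by elim: j => [|j IHj]; rewrite ?ffunE // !mulrS ffunE IHj.
case: k => k; first by rewrite N -mulr_natr natz.
by rewrite NegzE mulrNz ffunE N mulrN -mulr_natr natz.
Qed.

(** The k-th coordinates of L form a subgroup of Z, generated by a nonzero element of least absolute
    value if there is one; Euclidean division would otherwise produce a smaller one. *)
Lemma coord_generator (L : vec -> Prop) (sL : subgroup L) (k : 'I_m) :
  exists2 v0, L v0 & forall a, L a -> (v0 k %| a k)%Z.
Proof.
case: (pselect (exists2 v, L v & v k != 0)) => [[v Lv vk]|noL]; last first.
  exists 0 => [|a La]; first exact: sL.1.
  have [-> //|ak] := eqVneq (a k) 0; by case: noL; exists a.
have exP : exists d, `[< exists2 v, L v & v k != 0 /\ absz (v k) = d >].
  by exists (absz (v k)); apply/asboolP; exists v.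
case: (ex_minnP exP) => d /asboolP[v0 Lv0 [v0k v0d]] dmin.
exists v0 => // a La; apply: contraT => ndv; pose r := a - v0 *~ (a k %/ v0 k)%Z.
have rk : r k = (a k %% v0 k)%Z.
  by rewrite /r !ffunE ffunMz /modz mulrC.
have r0 : r k != 0 by apply: contra ndv; rewrite rk => /eqP/dvdz_mod0P.
have := dmin (absz (r k)); rewrite leqNgt => rmin.
suff : (absz (r k) < d)%N.
  rewrite (negPf (rmin _)) //; apply/asboolP; exists r => //.
  by apply: sL.2 => //; apply: subgroupMz.
have := ltz_mod (a k) v0k; have := modz_ge0 (a k) v0k; rewrite rk -v0d; lia.
Qed.

Definition lower (k : nat) (a : vec) : Prop := forall i : 'I_m, (k <= i)%N -> a i = 0.

Lemma dot_delta (lam : seq int) (c : int) (k : 'I_m) (e : int) :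
  exists lam' : seq int, forall a : vec, dot lam' a = c * dot lam a + e * a k.
Proof.
exists (mkseq (fun i => c * lam`_i + (if i == k :> nat then e else 0)) m) => a.
rewrite /dot mulr_sumr [e * _](_ : _ = \sum_(i < m) (if i == k :> nat then e else 0) * a i).
  by rewrite -big_split; apply: eq_bigr => i _; rewrite nth_mkseq // mulrDl mulrA.
rewrite (bigD1 k) //= eqxx big1 ?addr0 // => i ik.
by rewrite (inj_eq val_inj) (negPf ik) mul0r.
Qed.

(** Induction on the number of coordinates, as in the computation of an echelon form: a multiple of
    [v0] clears the last coordinate, and a functional found one dimension below is extended so as to
    vanish on [v0]. The two claims share this reduction. *)
Lemma lower_separation (k : nat) (L : vec -> Prop) (x : vec) :
  subgroup L -> (forall a, L a -> lower k a) -> lower k x ->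
  (~ L x -> exists lam (M : nat),
     (forall a, L a -> (M%:Z %| dot lam a)%Z) /\ ~~ (M%:Z %| dot lam x)%Z) /\
  ((forall j, (0 < j)%N -> ~ L (x *+ j)) -> exists lam,
     (forall a, L a -> dot lam a = 0) /\ dot lam x != 0).
Proof.
elim: k L x => [|k IHk] L x sL Lk xk.
  have x0 : x = 0 by apply/ffunP=> i; rewrite ffunE xk.
  split=> [nLx|nLx]; first by case: nLx; rewrite x0; apply: sL.1.
  by case: (nLx 1%N) => //; rewrite x0 mul0rn; apply: sL.1.
have [km|mk] := ltnP k m; last first.
  have low a : lower k a by move=> i ki; have := ltn_ord i; lia.
  by apply: IHk => // a _; apply: low.
pose k' := Ordinal km.
have lowS a : lower k.+1 a -> a k' = 0 -> lower k a.
  move=> ak ak' i; rewrite leq_eqVlt => /predU1P[ki|]; last exact: ak.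
  by rewrite (_ : i = k') //; apply: val_inj.
have [v0 Lv0 v0P] := coord_generator sL k'.
(* By [redL] below, L is generated by [L0] and [v0]. *)
pose L0 a := L a /\ a k' = 0.
have sL0 : subgroup L0.
  split; first by split; [apply: sL.1 | rewrite ffunE].
  by move=> a b [La ak] [Lb bk]; split; [apply: sL.2 | rewrite !ffunE ak bk subr0].
have L0k a : L0 a -> lower k a by move=> [La ak]; apply: lowS => //; apply: Lk.
have red a : L a -> a k' = v0 k' * (a k' %/ v0 k')%Z.
  by move=> La; rewrite mulrC divzK // v0P.
have redL a : L a -> L0 (a - v0 *~ (a k' %/ v0 k')%Z).
  move=> La; split; first by apply: sL.2 => //; apply: subgroupMz.
  by rewrite !ffunE ffunMz -red // subrr.
(* [lam'] vanishes on [v0] and restricts to [v0 k' * lam] on [L0]. *)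
have ext lam : exists lam', dot lam' v0 = 0 /\
    forall a, dot lam' a = v0 k' * dot lam a - dot lam v0 * a k'.
  have [lam' lamE] := dot_delta lam (v0 k') k' (- dot lam v0).
  by exists lam'; split=> [|a]; rewrite lamE mulNr // mulrC subrr.
have dotz lam a j : dot lam a = 0 -> dot lam (a *~ j) = 0.
  move=> a0; case: j => j; first by rewrite dotMn a0 mul0rn.
  by rewrite NegzE mulrNz dotN dotMn a0 mul0rn oppr0.
have dec lam a : L a -> dot lam v0 = 0 ->
    dot lam a = dot lam (a - v0 *~ (a k' %/ v0 k')%Z).
  by move=> La l0; rewrite dotB dotz // subr0.
have [lamk lamkE] := dot_delta [::] 0 k' 1.
have lamkP a : dot lamk a = a k' by rewrite lamkE mul0r add0r mul1r.
(* If [v0 k'] is 0, coordinate k' vanishes on L: either it vanishes at x too and the induction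
   hypothesis applies, or it separates x by itself. *)
have [d0|dn0] := eqVneq (v0 k') 0.
  have L00 a : L a -> a k' = 0.
    by move=> La; have := v0P a La; rewrite d0 dvd0z => /eqP.
  have [xk0|xk0] := eqVneq (x k') 0.
    by apply: IHk => //; [move=> a La; apply: lowS; [apply: Lk | apply: L00] | apply: lowS].
  split=> _; first exists lamk, 0%N; last exists lamk.
    split=> [a La|]; rewrite lamkP; first by rewrite L00 // dvdz0.
    by rewrite dvd0z.
  by split=> [a La|]; rewrite lamkP // L00.
split=> nLx.
  (* If [v0 k'] does not divide [x k'], coordinate k' modulo |[v0 k']| already separates x from
     L. *)
  have [dx|ndx] := boolP (v0 k' %| x k')%Z; last first.
    exists lamk, (absz (v0 k')); split=> [a La|]; rewrite lamkP dvdzE /=.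
      by rewrite -dvdzE v0P.
    by rewrite -dvdzE.
  pose y := x - v0 *~ (x k' %/ v0 k')%Z.
  have yk : y k' = 0 by rewrite /y !ffunE ffunMz mulrC divzK // subrr.
  have nLy : ~ L0 y.
    move=> [Ly _]; apply: nLx; rewrite -[x](subrK (v0 *~ (x k' %/ v0 k')%Z)).
    by apply: subgroupD => //; apply: subgroupMz.
  have low_y : lower k y.
    apply: lowS => // i ki; rewrite /y !ffunE ffunMz (xk i ki) (Lk _ Lv0 i ki).
    by rewrite mul0r subrr.
  have [/(_ nLy)[lam [M [lamL lamy]]] _] := IHk L0 y sL0 L0k low_y.
  have [lam' [lam0 lamE]] := ext lam.
  (* On [L0] the extension is [v0 k'] times [lam], so the modulus is scaled accordingly. *)
  exists lam', (absz (v0 k') * M)%N; split=> [a La|].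
    rewrite dec // lamE (redL a La).2 mulr0 subr0 dvdzE absz_nat abszM.
    by rewrite dvdn_pmul2l ?absz_gt0 //; apply: lamL (redL a La).
  have -> : dot lam' x = dot lam' y by rewrite dotB dotz // subr0.
  by rewrite lamE yk mulr0 subr0 dvdzE absz_nat abszM dvdn_pmul2l ?absz_gt0.
(* Here [v0 k'] need not divide [x k'], so x is first multiplied by |[v0 k']|; the sign makes the
   last coordinates cancel. *)
pose y := x *+ absz (v0 k') - v0 *~ (sgz (v0 k') * x k').
have yk : y k' = 0.
  rewrite /y !ffunE ffunMz -[_ *+ _]/(_ *~ (absz (v0 k'))%:Z) ffunMz.
  by rewrite abszE mulrA [v0 k' * _]mulrC -normrEsg mulrC subrr.
have low_y : lower k y.
  apply: lowS => // i ki; rewrite /y !ffunE ffunMz -[_ *+ _]/(_ *~ (absz (v0 k'))%:Z).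
  by rewrite ffunMz (xk i ki) (Lk _ Lv0 i ki) !mul0r subrr.
have nLy j : (0 < j)%N -> ~ L0 (y *+ j).
  move=> j0 [Ly _]; apply: (nLx (absz (v0 k') * j)%N); first by rewrite muln_gt0 absz_gt0 dn0.
  rewrite mulrnA -[x *+ _](subrK (v0 *~ (sgz (v0 k') * x k'))) mulrnDl.
  by apply: subgroupD => //; apply: subgroupMn => //; apply: subgroupMz.
have [_ /(_ nLy)[lam [lamL lamy]]] := IHk L0 y sL0 L0k low_y.
have [lam' [lam0 lamE]] := ext lam.
exists lam'; split=> [a La|].
  by rewrite dec // lamE (redL a La).2 lamL ?mulr0 ?subrr //; apply: redL.
have : dot lam' y != 0 by rewrite lamE yk mulr0 subr0 mulf_neq0.
by apply: contra => /eqP xl; rewrite dotB dotz // dotMn xl mul0rn subr0.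
Qed.

Lemma character_separation (L : vec -> Prop) (x : vec) :
  subgroup L -> ~ L x -> exists lam (M : nat),
    (forall a, L a -> (M%:Z %| dot lam a)%Z) /\ ~~ (M%:Z %| dot lam x)%Z.
Proof.
move=> sL; apply: (proj1 (@lower_separation m L x sL _ _)) => [a _|] i mi;
  by have := ltn_ord i; rewrite ltnNge mi.
Qed.

Lemma functional_separation (L : vec -> Prop) (x : vec) :
  subgroup L -> (forall j, (0 < j)%N -> ~ L (x *+ j)) -> exists lam,
    (forall a, L a -> dot lam a = 0) /\ dot lam x != 0.
Proof.
move=> sL; apply: (proj2 (@lower_separation m L x sL _ _)) => [a _|] i mi;
  by have := ltn_ord i; rewrite ltnNge mi.
Qed.

End Lattice.

(** * The part of the Schreier graph spanned by given words *)

Section SchreierGraph.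
Variables (n m : nat) (gens : seq (elt n m)).
Local Notation word := (seq (letter n)).
Local Notation vec := {ffun 'I_m -> int}.

Definition in_proj (w : word) : Prop := exists b, in_gen gens (w, b).
(** Equality of the right cosets P v and P w, where P is the projection of H to F_n; letters act on
    these by right multiplication. *)
Definition same_coset (v w : word) : Prop := in_proj (v ++ invw w).

Lemma in_proj_eq v w : reduce v = reduce w -> in_proj v -> in_proj w.
Proof. by move=> vw [b Hb]; exists b; apply: in_gen_eq vw Hb. Qed.

Lemma in_projM v w : in_proj v -> in_proj w -> in_proj (v ++ w).
Proof. by move=> [b Hb] [c Hc]; exists (b + c); apply: in_genM. Qed.

Lemma in_projV v : in_proj v -> in_proj (invw v).
Proof. by move=> [b Hb]; exists (- b); apply: in_genV. Qed.

Lemma same_coset_refl v : same_coset v v.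
Proof. by exists 0; apply: in_gen_eq (in_gen1 gens); rewrite reduce_invr. Qed.

Lemma same_coset_reduce v w : reduce v = reduce w -> same_coset v w.
Proof. by move=> vw; apply: in_proj_eq (same_coset_refl w); apply: reduce_catC. Qed.

Lemma same_coset_sym v w : same_coset v w -> same_coset w v.
Proof. by move=> /in_projV; rewrite invw_cat invwK. Qed.

Lemma same_coset_trans v u w : same_coset u v -> same_coset v w -> same_coset u w.
Proof.
move=> uv vw; apply: in_proj_eq (in_projM uv vw).
by rewrite -catA [invw v ++ _]catA reduce_cancel ?reduce_invl.
Qed.

Lemma same_coset_catr u v w : same_coset v w -> same_coset (v ++ u) (w ++ u).
Proof.
apply: in_proj_eq; rewrite invw_cat -catA [u ++ _]catA.
by rewrite reduce_cancel ?reduce_invr.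
Qed.

Lemma same_coset_nil v : same_coset v [::] <-> in_proj v.
Proof. by rewrite /same_coset cats0. Qed.

Variable V : seq word.

(** The vertex of a coset is the index of its first representative in V, and [size V] stands for a
    coset outside the graph. The test is classical: the graph only serves to prove that certificates
    exist. *)
Definition coset w : nat := find (fun v => `[< same_coset w v >]) V.
Local Notation rep := (nth [::] V).

Lemma coset_eq v w : same_coset v w -> coset v = coset w.
Proof.
move=> vw; apply: eq_find => u; apply/asboolP/asboolP.
  exact/same_coset_trans/same_coset_sym.
exact: same_coset_trans.
Qed.

Lemma coset_rep w : (coset w < size V)%N -> same_coset w (rep (coset w)).
Proof. by rewrite -has_find => /(nth_find [::])/asboolP. Qed.

Lemma coset_mem w : w \in V -> (coset w < size V)%N.
Proof.
rewrite -has_find => wV; apply/hasP; exists w => //; apply/asboolP.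
exact: same_coset_refl.
Qed.

Lemma coset_inj v w : (coset w < size V)%N -> coset v = coset w -> same_coset v w.
Proof.
move=> wV vw; apply: (same_coset_trans (v := rep (coset w))).
  by rewrite -vw; apply: coset_rep; rewrite vw.
exact/same_coset_sym/coset_rep.
Qed.

Lemma coset_repK w : (coset w < size V)%N -> coset (rep (coset w)) = coset w.
Proof. by move=> wV; apply/coset_eq/same_coset_sym/coset_rep. Qed.

Variables (lam : seq int) (T : word -> vec).
Hypothesis TP : forall w, in_proj w -> in_gen gens (w, T w).

Definition extend (i : nat) (l : 'I_n) : word := rcons (rep i) (true, l).
(** The argument of [T] is the Schreier generator of the edge, an element of P when the target coset
    is in the graph. Negative letters are read along inverse edges only, so opposite edges get
    opposite weights. *)
Definition pos_edge (i : nat) (l : 'I_n) : edge :=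
  let j := coset (extend i l) in
  ((i, (true, nat_of_ord l)), (dot lam (T (extend i l ++ invw (rep j))), j)).
(** V may contain several words of one coset; the second condition keeps only the first of them as a
    vertex. *)
Definition has_edge (i : nat) (l : 'I_n) : bool :=
  [&& (i < size V)%N, coset (rep i) == i & (coset (extend i l) < size V)%N].
Definition schreier : seq edge :=
  flatten [seq flatten [seq [:: pos_edge i l; inv_edge (pos_edge i l)]
    | l <- enum 'I_n & has_edge i l] | i <- iota 0 (size V)].

Lemma mem_schreier e : e \in schreier <-> exists i l, has_edge i l /\
  (e = pos_edge i l \/ e = inv_edge (pos_edge i l)).
Proof.
split=> [/flatten_mapP[i _ /flatten_mapP[l]]|[i [l [il el]]]].
  rewrite mem_filter !inE => /andP[il _] /orP[]/eqP->; exists i, l.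
    by split=> //; left.
  by split=> //; right.
apply/flatten_mapP; exists i; first by rewrite mem_iota; case/and3P: il.
apply/flatten_mapP; exists l; first by rewrite mem_filter il mem_enum.
by rewrite !inE; case: el => ->; rewrite eqxx ?orbT.
Qed.

Lemma inv_edgeK : involutive inv_edge.
Proof. by move=> [[v [b i]] [z v']]; rewrite /inv_edge /= negbK opprK. Qed.

(** Right multiplication by a letter permutes the cosets, so the end of an edge and its letter
    determine its start. *)
Lemma pos_edge_inj i l i' l' : has_edge i l -> has_edge i' l' ->
  (inv_edge (pos_edge i l)).1 = (inv_edge (pos_edge i' l')).1 -> i = i' /\ l = l'.
Proof.
move=> /and3P[iV /eqP ii jV] /and3P[iV' /eqP ii' jV'] /= [jj ll].
have {}ll : l = l' by apply: val_inj.
rewrite -{l'}ll in jj jV' *; split=> //; rewrite -ii -ii'; apply: coset_eq.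
have E v : same_coset (rcons v (true, l) ++ [:: (false, l)]) v.
  by apply: same_coset_reduce; rewrite -cats1; apply: (reduce_letterK v (true, l)).
have := same_coset_catr [:: (false, l)] (coset_inj jV' jj).
move=> /same_coset_trans/(_ (E _)); apply: same_coset_trans.
exact/same_coset_sym/E.
Qed.

Lemma folded_schreier : folded schreier.
Proof.
apply/allP=> e /mem_schreier[i [l [il el]]]; apply/andP; split.
  apply/allP=> e' /mem_schreier[i' [l' [il' el']]].
  have [/=ee'|//] := eqVneq; apply/eqP.
  case: el el' ee' => -> [] -> //.
    by move=> [-> /val_inj->].
  by move=> /(pos_edge_inj il il')[-> ->].
apply/hasP; exists (inv_edge e) => //; apply/mem_schreier; exists i, l.
by split=> //; case: el => ->; [right | left; rewrite inv_edgeK].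
Qed.

Lemma schreier_edge v x v' z :
  ((v, label x), (z, v')) \in schreier -> 
  [/\ (v < size V)%N, (v' < size V)%N, v' = coset (rep v ++ [:: x])
    & exists c, in_gen gens (rep v ++ x :: invw (rep v'), c) /\ z = dot lam c].
Proof.
case: x => e l0 /mem_schreier[i [l [/and3P[iV /eqP ii jV] el]]].
have ic := coset_rep jV; have := TP ic.
case: el => [[-> -> /val_inj -> -> ->]|[-> -> /val_inj -> -> ->]] H.
  split=> //; first by rewrite /extend cats1.
  by exists (T (extend i l ++ invw (rep (coset (extend i l))))); rewrite -cat_rcons.
split=> //.
  transitivity (coset (rep i)); first by rewrite ii.
  apply: coset_eq; have := same_coset_catr [:: (false, l)] ic.
  move=> H'; apply: same_coset_trans H'; apply/same_coset_sym/same_coset_reduce.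
  by rewrite /extend -cats1; apply: (reduce_letterK (rep i) (true, l)).
exists (- T (extend i l ++ invw (rep (coset (extend i l))))); split; last by rewrite dotN.
have := in_genV H; rewrite invw_cat invwK /extend -cats1 invw_cat.
by [].
Qed.

Lemma schreier_step v x : (v < size V)%N -> coset (rep v) = v ->
  (coset (rep v ++ [:: x]) < size V)%N ->
  exists z v', ((v, label x), (z, v')) \in schreier.
Proof.
case: x => -[] l vV vv jV.
  exists (pos_edge v l).2.1, (pos_edge v l).2.2; apply/mem_schreier; exists v, l.
  by split; [rewrite /has_edge vV vv eqxx /extend -cats1 | left].
(* A negative letter is read along the inverse of the positive edge that starts at the target coset
   j. *)
set j := coset _ in jV.
have jv : same_coset (extend j l) (rep v).
  have := same_coset_catr [:: (true, l)] (same_coset_sym (coset_rep jV)).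
  rewrite /extend -cats1 => /same_coset_trans; apply; apply: same_coset_reduce.
  exact: (reduce_letterK (rep v) (false, l)).
have ejl := coset_eq jv; rewrite vv in ejl.
exists (inv_edge (pos_edge j l)).2.1, j; apply/mem_schreier; exists j, l.
split; first by rewrite /has_edge ejl jV vV coset_repK ?eqxx.
by right; rewrite /inv_edge /= ejl.
Qed.

(** With the empty word in front, vertex 0 is P itself. Nonemptiness is asked separately because
    [head] also returns the empty word on an empty list. *)
Hypothesis V0 : head [::] V = [::].
Hypothesis V0s : (0 < size V)%N.

Lemma coset_nil w : coset w = 0%N <-> in_proj w.
Proof.
rewrite -same_coset_nil; have -> : [::] = rep 0 by rewrite nth0.
split=> [w0|]; first by rewrite -w0; apply: coset_rep; rewrite w0.
rewrite /coset; case: (V) V0s => //= v V' _ /asboolP.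
by rewrite /same_coset /= => ->.
Qed.

(** The Schreier generators along the walk telescope to w times the inverse of the representative of
    v, and their lifts to H multiply to a lift c of this word. *)
Lemma schreier_walk w v z : walk schreier w 0 v z ->
  [/\ v = coset w, (v < size V)%N
    & exists c, in_gen gens (w ++ invw (rep v), c) /\ z = dot lam c].
Proof.
elim/last_ind: w v z => [|w x IHw] v z.
  move=> [<- ->]; split=> //; first by apply/esym/coset_nil; exists 0; apply: in_gen1.
  by exists 0; rewrite dot0 nth0 V0; split=> //; apply: in_gen1.
rewrite -cats1 => /walk_cat[u [y [/IHw[uw uV [c [Hc yc]]]]]] [[k [z' v']]] [eD /= e1 [vv' /eqP]].
rewrite subr_eq0 subr_eq => /eqP-> {z}; rewrite {}e1 in eD.
move: eD => /schreier_edge[_ v'V v'E [c' [Hc' zc']]].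
rewrite -vv'; split=> //.
  rewrite v'E; apply: coset_eq; apply: same_coset_catr; apply: same_coset_sym.
  by rewrite uw; apply: coset_rep; rewrite -uw.
exists (c + c'); split; last by rewrite dotD -yc -zc' addrC.
apply: in_gen_eq (in_genM Hc Hc').
by rewrite -catA [invw _ ++ _]catA reduce_cancel ?reduce_invl // -catA.
Qed.

Lemma schreier_walk_def w : (forall k, (k <= size w)%N -> take k w \in V) ->
  exists v z, walk schreier w 0 v z.
Proof.
elim/last_ind: w => [|w x IHw] wV; first by exists 0%N, 0.
have [k kw|v [z wP]] := IHw.
  by have := wV k; rewrite size_rcons -cats1 takel_cat // => -> //; lia.
have [vE vV _] := schreier_walk wP.
have wxV : (coset (rcons w x) < size V)%N.
  by apply: coset_mem; have := wV (size (rcons w x)); rewrite take_size; apply.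
have wv : same_coset w (rep v) by rewrite vE; apply: coset_rep; rewrite -vE.
have [|||z' [v' eD]] := @schreier_step v x.
- by [].
- by rewrite -(coset_eq wv).
- by rewrite -(coset_eq (same_coset_catr [:: x] wv)) cats1.
exists v', (z + z'); rewrite -cats1; apply/walk_cat; exists v, z; split=> //.
by exists ((v, label x), (z', v')); split=> //=; split=> //; rewrite [z + z']addrC addrK subrr.
Qed.

End SchreierGraph.

(** * Certificates *)

Section Certificates.
Variables (n m : nat).
Local Notation word := (seq (letter n)).
Local Notation vec := {ffun 'I_m -> int}.
Implicit Types (gens : seq (elt n m)) (w : word) (a b : vec) (D : seq edge) (lam : seq int).

(** Two refutations in one: the path of w is not closed, so w is outside P, or it is closed with a
    weight not congruent to lam(b). *)
Definition separates D lam M gens w b : bool :=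
  covers D lam M gens && has (fun s => ~~ loop_ok lam M b s) (run D w).

(** The exponent is [k.+1] so that every k met during a search gives a positive power. *)
Definition unbounded D lam M gens w a k : bool :=
  covers D lam M gens &&
  (((M == 0%N) && has (fun s => (s.1 == 0%N) && (s.2 != dot lam a * k.+1%:Z))
                      (run D (powerw w k.+1)))
   || (let r := reduce (powerw w (k.+1 + k.+1)) in
       run D (take (size r)./2 r) == [::])).

Lemma separates_sound D lam M gens w b :
  separates D lam M gens w b -> ~ in_gen gens (w, b).
Proof.
move=> /andP[cD /hasP[[v y] /mem_run wy]] + Hw.
have [fD _] := andP cD; have [z wz zM] := covers_walk cD Hw.
have [-> ->] := walk_det fD (walk_reduce fD wy) wz.
by rewrite /loop_ok eqxx /= -[(_ %| _)%N]/(M%:Z %| z - dot lam b)%Z zM.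
Qed.

Lemma reduce_power w : exists c r, forall k, (0 < k)%N ->
  reduce (powerw w k) = c ++ powerw r k ++ invw c.
Proof.
have [c [r [wE rP]]] := cyclic_reduction (reduced_reduce w).
exists c, r => k k0; rewrite -(reduce_id (rP k k0)) -reduce_conj -wE.
by apply: powerw_reduce; rewrite reduceK.
Qed.

Lemma take_half_power (c r : word) k :
  let s := c ++ powerw r (k + k) ++ invw c in
  take (size s)./2 s = c ++ powerw r k.
Proof.
rewrite /= powerwD !size_cat size_invw -catA catA.
have -> : (size c + (size (powerw r k) + size (powerw r k) + size c))./2
   = size (c ++ powerw r k) by rewrite size_cat; lia.
by rewrite take_size_cat.
Qed.

Lemma unbounded_sound D lam M gens w a k j :
  unbounded D lam M gens w a k -> (0 < j)%N -> ~ in_gen gens (powerw w j, a *+ j).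
Proof.
move=> /andP[cD H] j0 Hj; have [fD _] := andP cD; case/orP: H.
  move=> /andP[/eqP M0 /hasP[[v y] /mem_run wy /andP[/= /eqP v0 yk]]].
  rewrite {}v0 in wy.
  (* The closed path of u^(k+1), run j times, has weight j y. Membership of the power j(k+1) demands
     j(k+1) lam(a), and j can be cancelled. *)
  have := in_genX k.+1 Hj; rewrite -powerwM -mulrnA mulnC.
  move=> /(covers_walk cD)[z]; rewrite M0 dvd0z subr_eq0 powerwM => wz /eqP zE.
  have wj : walk D (powerw (powerw w k.+1) j) 0 0 (y *+ j).
    elim: (j) => [|i IHi] //; rewrite powerwS; apply/walk_cat; exists 0%N, y.
    by rewrite mulrS addrC addrK.
  have [_ /eqP] := walk_det fD (walk_reduce fD wj) wz.
  rewrite zE mulrnA !dotMn -subr_eq0 -mulrnBl mulrn_eq0 eqn0Ngt j0 /=.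
  by rewrite subr_eq0 -mulr_natr natz (negPf yk).
have [c [r rP]] := reduce_power w.
rewrite /= rP // take_half_power => /eqP run0.
(* The power of u with exponent j(2k+2) would lie in P; its reduced form begins with c r^(k+1),
   which the automaton cannot read. *)
have := in_genX (k.+1 + k.+1) Hj; rewrite -powerwM -mulrnA.
move=> /(covers_walk cD)[z + _]; rewrite rP ?muln_gt0 ?j0 //.
have -> : (j * (k.+1 + k.+1) = k.+1 + (j * (k.+1 + k.+1) - k.+1))%N by nia.
rewrite powerwD -catA catA => /walk_cat[u [y [/mem_run]]].
by rewrite run0.
Qed.

(** The leading empty word provides the base vertex even when s is empty. *)
Definition prefixes (s : seq word) : seq word :=
  [::] :: flatten [seq [seq take k u | k <- iota 0 (size u).+1] | u <- s].

Lemma mem_prefixes s u k : u \in s -> (k <= size u)%N -> take k u \in prefixes s.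
Proof.
move=> us ku; rewrite inE; apply/orP; right; apply/flatten_mapP; exists u => //.
by apply/mapP; exists k; rewrite // mem_iota.
Qed.

Section Complete.
Variables (gens : seq (elt n m)) (T : word -> vec).
Hypothesis TP : forall w, in_proj gens w -> in_gen gens (w, T w).

Lemma prefixes_walk_def s lam w : w \in s ->
  exists v z, walk (schreier gens (prefixes s) lam T) w 0 v z.
Proof.
by move=> ws; apply: schreier_walk_def => // k; apply: mem_prefixes.
Qed.

Lemma prefixes_walk s lam w v z : walk (schreier gens (prefixes s) lam T) w 0 v z ->
  [/\ v = coset gens (prefixes s) w, (v < size (prefixes s))%N
    & exists c, in_gen gens (w ++ invw (nth [::] (prefixes s) v), c) /\ z = dot lam c].
Proof. exact: schreier_walk. Qed.

(** The path of a generator w t^b is closed with weight lam(c), where w t^c is also in H. Then c - b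
    lies in H /\ Z^m, where lam vanishes modulo M. *)
Lemma covers_schreier s lam M :
  {subset map fst gens <= s} ->
  (forall a, in_gen gens ([::], a) -> (M%:Z %| dot lam a)%Z) ->
  covers (schreier gens (prefixes s) lam T) lam M gens.
Proof.
move=> gs lamM; apply/andP; split; first exact: folded_schreier.
apply/allP=> -[w b] gw; apply/hasP.
have ws : w \in s by apply/gs/mapP; exists (w, b).
have [v [z wz]] := prefixes_walk_def lam ws.
exists (v, z); first exact/mem_run.
have [vE _ [c [Hc ->]]] := prefixes_walk wz.
have v0 : v = 0%N by rewrite vE; apply/coset_nil => //; exists b; apply: in_gen_gen.
rewrite /loop_ok /= v0 eqxx /= -dotB; apply: lamM.
rewrite v0 /= cats0 in Hc.
apply: in_gen_eq (in_genM Hc (in_genV (in_gen_gen gw))).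
by rewrite reduce_invr.
Qed.

Lemma dot_congr lam M w b c :
  (forall a, in_gen gens ([::], a) -> (M%:Z %| dot lam a)%Z) ->
  in_gen gens (w, b) -> in_gen gens (w, c) -> (M%:Z %| dot lam b - dot lam c)%Z.
Proof.
move=> lamM Hb Hc; rewrite -dotB; apply: lamM.
by apply: in_gen_eq (in_genM Hb (in_genV Hc)); rewrite reduce_invr.
Qed.

Lemma subgroup_kernel : subgroup (fun b => in_gen gens ([::], b)).
Proof. by split=> [|a b Ha Hb]; [apply: in_gen1 | apply: in_genM Ha (in_genV Hb)]. Qed.

Lemma separates_complete w b :
  ~ in_gen gens (w, b) -> exists D lam M, separates D lam M gens w b.
Proof.
move=> nH; pose s := w :: map fst gens.
have gs : {subset map fst gens <= s} by move=> u; rewrite inE orbC => ->.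
suff [lam [M [lamM wb]]] : exists lam (M : nat),
    (forall a, in_gen gens ([::], a) -> (M%:Z %| dot lam a)%Z) /\
    (forall c, in_gen gens (w, c) -> ~~ (M%:Z %| dot lam c - dot lam b)%Z).
  exists (schreier gens (prefixes s) lam T), lam, M.
  rewrite /separates covers_schreier //=; apply/hasP.
  have [v [z wz]] := prefixes_walk_def lam (mem_head w (map fst gens)).
  exists (v, z); first exact/mem_run.
  rewrite /loop_ok negb_and /=; have [v0|//] := eqVneq v 0%N.
  have [_ _ [c [Hc ->]]] := prefixes_walk wz.
  by rewrite v0 /= cats0 in Hc; apply: wb.
case: (pselect (in_proj gens w)) => [[c Hc]|nPw]; last first.
  (* Outside P the path of w is not closed, so the zero functional suffices. *)
  exists [::], 0%N; split=> [a _|c Hc]; last by case: nPw; exists c.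
  by rewrite /dot big1 // => i _; rewrite nth_nil mul0r.
(* Inside P, w t^c is in H and w t^b is not, so c - b is outside H /\ Z^m and a functional modulo
   some M detects it. *)
have nL : ~ in_gen gens ([::], c - b).
  move=> Hcb; apply: nH; have := in_genM (in_genV Hcb) Hc.
  by rewrite opprB subrK.
have [lam [M [lamM lamcb]]] := character_separation subgroup_kernel nL.
exists lam, M; split=> // d Hd; apply: contra lamcb => Md.
by rewrite dotB -(subrK (dot lam d) (dot lam c)) -addrA rpredD // (dot_congr lamM Hc Hd).
Qed.

(** Pigeonhole: if every c r^(k+1) could be read, two of them would end in the same coset, and their
    quotient c r^(k-l) c^-1, which is u^(k-l), would lie in P. *)
Lemma escaping_power w : (forall j, (0 < j)%N -> ~ in_proj gens (powerw w j)) ->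
  forall s lam, exists k, let r := reduce (powerw w (k.+1 + k.+1)) in
  run (schreier gens (prefixes s) lam T) (take (size r)./2 r) = [::].
Proof.
move=> nP s lam; set D := schreier _ _ _ _; set V := prefixes s in D *.
have [c [r rP]] := reduce_power w.
apply: contrapT => nE.
have cV k : (coset gens V (c ++ powerw r k.+1) < size V)%N.
  apply: contrapT => cV; apply: nE; exists k; rewrite /= rP // take_half_power.
  case E: run => [|[v z] st] //; case: cV.
  have /mem_run wz : (v, z) \in run D (c ++ powerw r k.+1) by rewrite E mem_head.
  by have [<-] := prefixes_walk wz.
have inj : injective (fun k => coset gens V (c ++ powerw r k.+1)).
  move=> k l kl; wlog lt_lk : k l kl / (l < k)%N.
    move=> H; case: (ltngtP k l) => // [lt_kl|lt_lk]; last exact: H kl lt_lk.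
    by apply: esym; apply: H (esym kl) lt_kl.
  have [] := nP (k - l)%N; first by rewrite subn_gt0.
  have := coset_inj (cV l) kl; apply: in_proj_eq; rewrite rP ?subn_gt0 //.
  have -> : k.+1 = (k - l + l.+1)%N by lia.
  rewrite powerwD invw_cat.
  transitivity (reduce ((c ++ powerw r (k - l)) ++
    (powerw r l.+1 ++ invw (powerw r l.+1)) ++ invw c)); first by rewrite !catA.
  rewrite reduce_cancel ?reduce_invr // -catA.
  by rewrite -rP ?reduceK // subn_gt0.
have := uniq_leq_size (s1 := [seq coset gens V (c ++ powerw r k.+1) | k <- iota 0 (size V).+1])
  (s2 := iota 0 (size V)).
rewrite map_inj_uniq // iota_uniq size_map !size_iota ltnn => /(_ isT) H.
suff : false by [].
by apply: H => _ /mapP[k _ ->]; rewrite mem_iota cV.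
Qed.

Lemma unbounded_complete w a :
  (forall j, (0 < j)%N -> ~ in_gen gens (powerw w j, a *+ j)) ->
  exists D lam M k, unbounded D lam M gens w a k.
Proof.
move=> nH; have [[k [k0 [b0 Hb0]]]|nP] :=
    pselect (exists k, (0 < k)%N /\ in_proj gens (powerw w k)); last first.
  have nP' j : (0 < j)%N -> ~ in_proj gens (powerw w j) by move=> j0 Pj; apply: nP; exists j.
  pose s := map fst gens.
  have [k kP] := escaping_power nP' s [::].
  exists (schreier gens (prefixes s) [::] T), [::], 0%N, k.
  rewrite /unbounded kP eqxx orbT andbT; apply: covers_schreier => // b _.
  by rewrite /dot big1 // => i _; rewrite nth_nil mul0r.
(* Multiplying such an element by (u^k t^b0)^j would put the power kj of u t^a into H. *)
have nL j : (0 < j)%N -> ~ in_gen gens ([::], (a *+ k - b0) *+ j).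
  move=> j0 Hj; apply: (nH (k * j)%N); first by rewrite muln_gt0 k0.
  have := in_genM Hj (in_genX j Hb0).
  by rewrite mulrnBl subrK -powerwM mulrnA.
have [lam [lam0 lamx]] := functional_separation subgroup_kernel nL.
have lamM b : in_gen gens ([::], b) -> (0%N%:Z %| dot lam b)%Z.
  by move=> /lam0->; rewrite dvdz0.
pose s := powerw w k :: map fst gens.
have gs : {subset map fst gens <= s} by move=> u; rewrite inE orbC => ->.
(* M = 0 because [lam] vanishes exactly on H /\ Z^m; [k.-1] compensates for the successor in
   [unbounded]. *)
exists (schreier gens (prefixes s) lam T), lam, 0%N, k.-1.
rewrite /unbounded covers_schreier //= prednK //; apply/orP; left; apply/hasP.
have [v [z wz]] := prefixes_walk_def lam (mem_head (powerw w k) (map fst gens)).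
exists (v, z); first exact/mem_run.
have [vE _ [c [Hc zE]]] := prefixes_walk wz.
have v0 : v = 0%N by rewrite vE; apply/coset_nil => //; exists b0.
rewrite v0 /= cats0 in Hc; rewrite /= v0 eqxx zE /=; apply: contra lamx => /eqP ck.
have := dot_congr lamM Hc Hb0; rewrite dvd0z subr_eq0 => /eqP cb.
by rewrite dotB dotMn -mulr_natr natz -ck cb subrr.
Qed.

End Complete.

Lemma in_proj_choice gens : exists T : word -> vec,
  forall w, in_proj gens w -> in_gen gens (w, T w).
Proof.
have /choice[T TP] : forall w, exists b, in_proj gens w -> in_gen gens (w, b).
  move=> w; case: (pselect (in_proj gens w)) => [[b Hb]|nP]; first by exists b.
  by exists 0.
by exists T.
Qed.

End Certificates.

(** * Computability of the certificates *)

(* Unbounded search also visits numbers that are not in the image of [pickle], hence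
   the total decoder [d]. *)
Definition searchable (A : countType) : Prop :=
  exists2 d : nat -> A, computable d & forall a, exists c, d c = a.

(** Every natural number is the code of the list it decodes to, so on codes this map is the
    identity. *)
Lemma comp_decode (X : countType) (f : X -> nat) :
  computable f -> computable (fun x => CodeSeq.decode (f x)).
Proof.
apply: comp_recode => x; rewrite -[LHS]/(f x) -[in LHS](CodeSeq.decodeK (f x)).
by congr CodeSeq.code; rewrite -[LHS]map_id.
Qed.

Lemma searchable_nat : searchable nat.
Proof. by exists id => [|c]; [apply: comp_id | exists c]. Qed.

Lemma searchable_bool : searchable bool.
Proof.
exists (fun c => c == 0%N) => [|[]]; first auto_comp.
  by exists 0%N.
by exists 1%N.
Qed.

Lemma searchable_prod (A B : countType) :
  searchable A -> searchable B -> searchable (A * B)%type.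
Proof.
move=> [d cd dP] [e ce eP].
exists (fun c => (d (nth 0%N (CodeSeq.decode c) 0), e (nth 0%N (CodeSeq.decode c) 1))).
  apply: comp_pair; [apply: (comp_comp cd) | apply: (comp_comp ce)];
    by apply: comp_nth; [auto_comp | apply: comp_decode; auto_comp | auto_comp].
move=> [a b]; have [[x <-] [y <-]] := (dP a, eP b).
by exists (CodeSeq.code [:: x; y]); rewrite CodeSeq.codeK.
Qed.

Lemma searchable_seq (A : countType) : searchable A -> searchable (seq A).
Proof.
move=> [d cd dP]; exists (fun c => map d (CodeSeq.decode c)).
  by apply: comp_map; [apply: (comp_comp cd); auto_comp | apply: comp_decode; auto_comp].
move=> s; suff [t <-] : exists t, map d t = s.
  by exists (CodeSeq.code t); rewrite CodeSeq.codeK.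
elim: s => [|a s [t <-]]; first by exists [::].
by have [c <-] := dP a; exists (c :: t).
Qed.

Lemma searchable_int : searchable int.
Proof.
have [d cd dP] := searchable_prod searchable_nat searchable_nat.
exists (fun c => int_of_diff (d c).1 (d c).2); first by auto_comp.
move=> z; have [c cz] := dP (int_pos z, int_neg z); exists c.
by rewrite cz -int_posneg.
Qed.

(* Post's theorem. *)
Lemma computable_decision (X A B : countType) (R : X -> Prop)
    (P : X -> A -> bool) (Q : X -> B -> bool) :
  searchable A -> searchable B ->
  computable (fun p : X * A => P p.1 p.2) -> computable (fun p : X * B => Q p.1 p.2) ->
  (forall x a, P x a -> R x) -> (forall x, R x -> exists a, P x a) ->
  (forall x b, Q x b -> ~ R x) -> (forall x, ~ R x -> exists b, Q x b) ->
  exists2 f : X -> bool, computable f & forall x, f x <-> R x.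
Proof.
move=> [d cd dP] [e ce eP] cP cQ PR RP QR RQ.
pose S x c := P x (d c) || Q x (e c).
have exS x : exists c, S x c.
  case: (pselect (R x)) => [/RP[a]|/RQ[b]].
    by have [c <-] := dP a => Pc; exists c; rewrite /S Pc.
  by have [c <-] := eP b => Qc; exists c; rewrite /S Qc orbT.
have cS : computable (fun p : X * nat => S p.1 p.2).
  apply: comp_orb; [apply: (comp_app2 cP) | apply: (comp_app2 cQ)]; try auto_comp.
    by apply: (comp_comp cd); auto_comp.
  by apply: (comp_comp ce); auto_comp.
(* At the first index carrying a valid certificate of either kind, P tells which side holds, as the
   two kinds exclude each other. *)
exists (fun x => P x (d (ex_minn (exS x)))).
  apply: (comp_app2 cP); first auto_comp.
  by apply: (comp_comp cd); apply: comp_ex_minn.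
move=> x; case: ex_minnP => c /orP[Pc|Qc] _; first by split=> // _; apply: PR Pc.
by split=> [/PR //|]; move: (QR _ _ Qc).
Qed.

(** * Computable checkers, the membership problem and the existence of a power in H *)

Section Checkers.
Variables (n m : nat).
Local Notation word := (seq (letter n)).
Local Notation vec := {ffun 'I_m -> int}.

Lemma comp_ord (X : countType) k (f : X -> 'I_k) :
  computable f -> computable (fun x => nat_of_ord (f x)).
Proof. by apply: comp_recode. Qed.

Lemma comp_inv_letter (X : countType) (f : X -> letter n) :
  computable f -> computable (fun x => inv_letter (f x)).
Proof. by move=> cf; rewrite /inv_letter; auto_comp. Qed.

Lemma comp_reduce (X : countType) (w : X -> word) :
  computable w -> computable (fun x => reduce (w x)).
Proof.
move=> cw; apply: (@comp_foldr _ _ _ (fun _ : X => @push n)) => //; last auto_comp.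
cbv beta; rewrite /push.
apply: (@comp_seq_case _ _ _ _ (fun (p : X * (letter n * word)) y t =>
  if y == inv_letter p.2.1 then t else p.2.1 :: p.2.2)); try auto_comp.
by apply: comp_if; [apply: comp_eqb; [| apply: comp_inv_letter] | |]; auto_comp.
Qed.

Lemma comp_invw (X : countType) (w : X -> word) :
  computable w -> computable (fun x => invw (w x)).
Proof.
by move=> cw; apply/comp_rev/comp_map => //; apply: comp_inv_letter; auto_comp.
Qed.

Lemma comp_powerw (X : countType) (w : X -> word) k :
  computable w -> computable k -> computable (fun x => powerw (w x) (k x)).
Proof. by move=> cw ck; rewrite /powerw; auto_comp. Qed.

(** Indexing by natural numbers lets the checkers range over [iota 0 m] instead of ordinals. *)
Definition coord (a : vec) (i : nat) : int := nth 0 [seq a k | k <- enum 'I_m] i.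

Lemma coordE (a : vec) (i : 'I_m) : coord a i = a i.
Proof. by rewrite /coord (nth_map i) ?size_enum_ord // nth_ord_enum. Qed.

Lemma comp_coord (X : countType) (a : X -> vec) i :
  computable a -> computable i -> computable (fun x => coord (a x) (i x)).
Proof.
move=> ca ci; apply: (@eq_computable _ _ (fun x =>
  nth 0 [seq p.2 | p <- [seq (nat_of_ord k, a x k) | k : 'I_m <- enum 'I_m]] (i x))).
  by move=> x; rewrite /coord -map_comp.
by apply: comp_nth => //; [auto_comp | apply: comp_map; [auto_comp | apply: comp_ffun]].
Qed.

Lemma comp_dot (X : countType) (lam : X -> seq int) (a : X -> vec) :
  computable lam -> computable a -> computable (fun x => dot (lam x) (a x)).
Proof.
move=> cl ca; apply: (@eq_computable _ _ (fun x =>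
  foldr (fun p c => nth 0 (lam x) p.1 * p.2 + c) 0
    [seq (nat_of_ord k, a x k) | k : 'I_m <- enum 'I_m])).
  move=> x; rewrite /dot -big_enum.
  by elim: (enum _) => [|i s IHs]; rewrite ?big_nil ?big_cons //= IHs.
apply: (@comp_foldr _ _ _ (fun x (p : nat * int) c => nth 0 (lam x) p.1 * p.2 + c));
  [|auto_comp|exact: comp_ffun].
cbv beta; apply: comp_add; last auto_comp.
apply: comp_mul; last auto_comp.
by apply: comp_nth; [auto_comp | apply: (comp_comp cl); auto_comp | auto_comp].
Qed.

Lemma comp_run (X : countType) (D : X -> seq edge) (w : X -> word) :
  computable D -> computable w -> computable (fun x => run (D x) (w x)).
Proof.
move=> cD cw; apply: (@comp_foldl _ _ _ (fun x => @run_step n (D x))) => //; last auto_comp.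
cbv beta; rewrite /run_step; apply: comp_flatten; apply: comp_map; last auto_comp.
apply: comp_map; first auto_comp.
apply: comp_filter; last by apply: (comp_comp cD); auto_comp.
apply: comp_eqb; first auto_comp.
rewrite /label; apply: comp_pair; first auto_comp.
by apply: comp_pair; [auto_comp | apply: comp_ord; auto_comp].
Qed.

Lemma comp_loop_ok (X : countType) lam M (a : X -> vec) s :
  computable lam -> computable M -> computable a -> computable s ->
  computable (fun x => loop_ok (lam x) (M x) (a x) (s x)).
Proof.
move=> cl cM ca cs; rewrite /loop_ok.
by repeat first [apply: comp_dot | progress comp_step].
Qed.

Lemma comp_folded (X : countType) D : computable D -> computable (fun x : X => folded (D x)).
Proof.
move=> cD; rewrite /folded /inv_edge.
have cD1 (A : countType) : computable (fun p : X * A => D p.1) by apply: (comp_comp cD); auto_comp.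
apply: comp_all => //; apply: comp_andb; first by apply: comp_all; [auto_comp | apply: cD1].
by apply: comp_has; [auto_comp | apply: cD1].
Qed.

Lemma comp_covers (X : countType) D lam M (gens : X -> seq (elt n m)) :
  computable D -> computable lam -> computable M -> computable gens ->
  computable (fun x => covers (D x) (lam x) (M x) (gens x)).
Proof.
move=> cD cl cM cg; apply: comp_andb; first exact: comp_folded.
apply: comp_all => //; apply: comp_has.
  by apply: comp_loop_ok; [apply: (comp_comp cl) | apply: (comp_comp cM) | |]; auto_comp.
by apply: comp_run; [apply: (comp_comp cD) |]; auto_comp.
Qed.

Lemma comp_separates (X : countType) D lam M (gens : X -> seq (elt n m)) w b :
  computable D -> computable lam -> computable M -> computable gens ->
  computable w -> computable b ->
  computable (fun x => separates (D x) (lam x) (M x) (gens x) (w x) (b x)).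
Proof.
move=> cD cl cM cg cw cb; apply: comp_andb; first exact: comp_covers.
apply: comp_has; last exact: comp_run.
by apply: comp_negb; apply: comp_loop_ok;
  [apply: (comp_comp cl) | apply: (comp_comp cM) | apply: (comp_comp cb) |]; auto_comp.
Qed.

Lemma comp_unbounded (X : countType) D lam M (gens : X -> seq (elt n m)) w a k :
  computable D -> computable lam -> computable M -> computable gens ->
  computable w -> computable a -> computable k ->
  computable (fun x => unbounded (D x) (lam x) (M x) (gens x) (w x) (a x) (k x)).
Proof.
move=> cD cl cM cg cw ca ck; apply: comp_andb; first exact: comp_covers.
apply: comp_orb.
  apply: comp_andb; first auto_comp.
  apply: comp_has; last by apply: comp_run => //; apply: comp_powerw => //; auto_comp.
  apply: comp_andb; first auto_comp.
  apply: comp_negb; apply: comp_eqb; first auto_comp.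
  apply: comp_mul.
    by apply: comp_dot; [apply: (comp_comp cl) | apply: (comp_comp ca)]; auto_comp.
  apply: (@eq_computable _ _ (fun p => int_of_diff (k p.1).+1 0)).
    by move=> p; rewrite /int_of_diff subr0.
  apply: comp_int_of_diff; last auto_comp.
  by apply: comp_succn; apply: (comp_comp ck); auto_comp.
have cr : computable (fun x => reduce (powerw (w x) ((k x).+1 + (k x).+1))).
  by apply: comp_reduce; apply: comp_powerw => //; auto_comp.
apply: comp_eqb; last auto_comp.
by apply: comp_run => //; auto_comp.
Qed.

(** Certificates name generators by their index. Indices out of range are dropped, so every
    certificate spells a product of generators and their inverses. *)
Definition factors (gens : seq (elt n m)) (c : seq (bool * nat)) :=
  [seq (p.1, nth (oneG n m) gens p.2) | p <- c & (p.2 < size gens)%N].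

Definition expresses gens w a c : bool :=
  let s := factors gens c in
  (reduce (flatten (map (@signed_word n m) s)) == reduce w) &&
  all (fun i => foldr (fun p z =>
    (if p.1 then coord p.2.2 i else - coord p.2.2 i) + z) 0 s == coord a i) (iota 0 m).

Lemma sum_signed_vec (s : seq (bool * elt n m)) (i : 'I_m) :
  (\sum_(p <- s) signed_vec p) i =
  foldr (fun p z => (if p.1 then coord p.2.2 i else - coord p.2.2 i) + z) 0 s.
Proof.
elim: s => [|p s IHs]; first by rewrite big_nil ffunE.
by rewrite big_cons ffunE IHs /= /signed_vec !coordE; case: p.1; rewrite ?ffunE.
Qed.

Lemma expressesP gens w a : in_gen gens (w, a) <-> exists c, expresses gens w a c.
Proof.
rewrite in_genP; split=> [[s sg [sw sa]]|[c /andP[/eqP sw /allP sa]]].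
  exists [seq (p.1, index p.2 gens) | p <- s]; rewrite /expresses.
  have -> : factors gens [seq (p.1, index p.2 gens) | p <- s] = s.
    rewrite /factors; elim: s sg {sw sa} => //= -[e g] s IHs /andP[/= gg sg].
    by rewrite index_mem gg /= nth_index // IHs.
  rewrite sw eqxx /=; apply/allP=> i; rewrite mem_iota => im.
  by rewrite -(sum_signed_vec s (Ordinal im)) sa -[X in coord a X]/(val (Ordinal im)) coordE.
exists (factors gens c).
  by apply/allP=> p /mapP[q]; rewrite mem_filter => /andP[qg _] ->; apply: mem_nth.
split=> //; apply/ffunP=> i; rewrite sum_signed_vec.
by rewrite -(coordE a); apply/eqP/sa; rewrite mem_iota /=.
Qed.

Lemma comp_signed_word (X : countType) (p : X -> bool * elt n m) :
  computable p -> computable (fun x => signed_word (p x)).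
Proof.
by move=> cp; apply: comp_if; [auto_comp | auto_comp | apply: comp_invw; auto_comp].
Qed.

Lemma comp_expresses (X : countType) (gens : X -> seq (elt n m)) w a c :
  computable gens -> computable w -> computable a -> computable c ->
  computable (fun x => expresses (gens x) (w x) (a x) (c x)).
Proof.
move=> cg cw ca cc.
have cs : computable (fun x => factors (gens x) (c x)).
  rewrite /factors; apply: comp_map.
    apply: comp_pair; first auto_comp.
    by apply: comp_nth; [auto_comp | apply: (comp_comp cg); auto_comp | auto_comp].
  apply: comp_filter => //; apply: comp_leq; first auto_comp.
  by apply: comp_size; apply: (comp_comp cg); auto_comp.
apply: comp_andb.
  apply: comp_eqb; apply: comp_reduce => //; apply: comp_flatten.
  by apply: comp_map => //; apply: comp_signed_word; auto_comp.
apply: comp_all; last auto_comp.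
apply: comp_eqb; last by apply: comp_coord; [apply: (comp_comp ca) |]; auto_comp.
apply: (@comp_foldr _ _ _ (fun (q : X * nat) (p : bool * elt n m) z =>
  (if p.1 then coord p.2.2 q.2 else - coord p.2.2 q.2) + z)); last first.
- by apply: (comp_comp cs); auto_comp.
- auto_comp.
cbv beta; apply: comp_add; last auto_comp.
have co : computable (fun p : X * nat * (bool * elt n m * int) => coord p.2.1.2.2 p.1.2).
  by apply: comp_coord; auto_comp.
by apply: comp_if; [auto_comp | | apply: comp_opp].
Qed.

Lemma searchable_edge : searchable edge.
Proof.
have := (searchable_nat, searchable_bool, searchable_int) => -[[sn sb] sz].
by do !apply: searchable_prod.
Qed.

(** Products of generators certify membership, and weighted automata certify non-membership. *)
Lemma in_gen_decision : exists2 f : seq (elt n m) * (word * vec) -> bool,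
  computable f & forall gens w a, f (gens, (w, a)) <-> in_gen gens (w, a).
Proof.
have [||||||||f cf fP] := @computable_decision
  (seq (elt n m) * (word * vec))%type (seq (bool * nat))
  (seq edge * (seq int * nat))%type (fun x => in_gen x.1 x.2)
  (fun x c => expresses x.1 x.2.1 x.2.2 c)
  (fun x D => separates D.1 D.2.1 D.2.2 x.1 x.2.1 x.2.2).
- apply: searchable_seq.
  by apply: searchable_prod; [apply: searchable_bool | apply: searchable_nat].
- apply: searchable_prod; first exact: searchable_seq searchable_edge.
  by apply: searchable_prod; [apply: searchable_seq searchable_int | apply: searchable_nat].
- by apply: comp_expresses; auto_comp.
- by apply: comp_separates; auto_comp.
- by move=> [gens [w a]] c /= H; apply/expressesP; exists c.
- by move=> [gens [w a]] /expressesP.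
- by move=> [gens [w a]] [D [lam M]] /separates_sound.
- move=> [gens [w a]] H; have [T TP] := in_proj_choice gens.
  have [D [lam [M sep]]] := separates_complete TP H.
  by exists (D, (lam, M)).
by exists f => // gens w a; apply: fP.
Qed.

Lemma comp_mulrn (X : countType) (a : X -> vec) k :
  computable a -> computable k -> computable (fun x => a x *+ k x).
Proof.
move=> ca ck; apply: (@comp_recode _ _ _ (fun x => [seq (p.1, p.2 * int_of_diff (k x) 0)
   | p <- [seq (nat_of_ord i, a x i) | i : 'I_m <- enum 'I_m]])).
  move=> x; rewrite pickle_ffun -map_comp; congr pickle; apply: eq_map => i /=.
  by rewrite -[a x *+ k x]/(a x *~ (k x)%:Z) ffunMz /int_of_diff subr0.
apply: comp_map; last exact: comp_ffun.
apply: comp_pair; first auto_comp.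
apply: comp_mul; first auto_comp.
by apply: comp_int_of_diff; [apply: (comp_comp ck) |]; auto_comp.
Qed.

Definition power_in (x : seq (elt n m) * (word * vec)) (k : nat) : Prop :=
  in_gen x.1 (powerw x.2.1 k, x.2.2 *+ k).

(** Once membership is decidable, an exponent alone certifies the positive side; the negative side
    is certified by [unbounded]. *)
Lemma torsion_decision : exists2 f : seq (elt n m) * (word * vec) -> bool,
  computable f & forall x, f x <-> exists k, power_in x k.+1.
Proof.
have [mem cmem memP] := in_gen_decision.
have Pgt0 (x : seq (elt n m) * (word * vec)) :
    ~ (exists k, power_in x k.+1) -> forall j, (0 < j)%N -> ~ power_in x j.
  by move=> nE [//|j] _ xj; apply: nE; exists j.
apply: (@computable_decision (seq (elt n m) * (word * vec))%type nat
  (seq edge * (seq int * (nat * nat)))%type (fun x => exists k, power_in x k.+1)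
  (fun x k => mem (x.1, (powerw x.2.1 k.+1, x.2.2 *+ k.+1)))
  (fun x D => unbounded D.1 D.2.1 D.2.2.1 x.1 x.2.1 x.2.2 D.2.2.2)).
- exact: searchable_nat.
- apply: searchable_prod; first exact: searchable_seq searchable_edge.
  apply: searchable_prod; first exact: searchable_seq searchable_int.
  by apply: searchable_prod; apply: searchable_nat.
- apply: (comp_comp cmem); apply: comp_pair; first auto_comp.
  by apply: comp_pair; [apply: comp_powerw | apply: comp_mulrn]; auto_comp.
- by apply: comp_unbounded; auto_comp.
- by move=> x k /memP; exists k.
- by move=> x [k xk]; exists k; apply/memP.
- by move=> x D /unbounded_sound H [k xk]; apply: (H k.+1).
move=> x /Pgt0 H; have [T TP] := in_proj_choice x.1.
have [D [lam [M [k unb]]]] := unbounded_complete TP H.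
by exists (D, (lam, (M, k))).
Qed.

End Checkers.

Theorem theorem7p23 (n m : nat) :
  exists p : prog,
    forall (gens : seq (elt n m)) (g : elt n m),
      exists k : nat, eval p [:: encode_input gens g] k /\ is_Ord gens g k.
Proof.
have [mem cmem memP] := in_gen_decision n m.
have [tor ctor torP] := torsion_decision n m.
(* The second disjunct makes the search for the least exponent end on every input, as [comp_if]
   evaluates it even when the answer is 0. *)
pose P (x : seq (elt n m) * elt n m) k :=
  mem (x.1, (powerw x.2.1 k.+1, x.2.2 *+ k.+1)) || ~~ tor x.
have exP x : exists k, P x k.
  have [/torP[k xk]|nx] := boolP (tor x); last by exists 0%N; rewrite /P nx orbT.
  by exists k; apply/orP; left; apply/memP.
(* The search runs over exponents minus one, whence the successor; 0 is left for the case without a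
   positive power in H. *)
have [p pP] : computable (fun x => if tor x then (ex_minn (exP x)).+1 else 0%N).
  apply: comp_if => //; last auto_comp.
  apply: comp_succn; apply: comp_ex_minn; apply: comp_orb.
    apply: (comp_comp cmem); apply: comp_pair; first auto_comp.
    by apply: comp_pair; [apply: comp_powerw | apply: comp_mulrn]; auto_comp.
  by apply: comp_negb; apply: (comp_comp ctor); auto_comp.
exists p => gens g; exists (if tor (gens, g) then (ex_minn (exP (gens, g))).+1 else 0%N).
split; first exact: (pP (gens, g)).
case: g => w a; rewrite /is_Ord; have [tx|ntx] := boolP (tor _); last first.
  rewrite eqxx => -[//|j] _ /in_gen_expG xj; case/negP: ntx.
  by apply/torP; exists j.
case: ex_minnP => k; rewrite /P tx orbF /= => /memP xk kmin; split.
  exact: (proj2 (in_gen_expG gens w a k.+1) xk).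
move=> [//|j] jk /in_gen_expG xj.
have kj : (k <= j)%N by apply: kmin; rewrite orbF; apply/memP.
by move: jk; rewrite /= ltnS ltnNge kj.
Qed.
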